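(* Let $n\ge 1$ and $e,l\ge 0$ be integers, let rotation $\mathrm{rot}_n$ act on $\mathrm{NCC}^B(n+1,e,l)$, and let $$\mathbf{Ncc}(n,e,l;q):=q^{e(e+1)+(n+1)l}\begin{bmatrix} n\\ 2e\end{bmatrix}_q\mathbf{Cat}(e;q)\begin{bmatrix} n-2e\\ l\end{bmatrix}_q.$$ Then $$\bigl(\mathrm{NCC}^B(n+1,e,l),\ \langle\mathrm{rot}_n\rangle,\ (1+[e]_q)\,\mathbf{Ncc}(n,e,l;q)\bigr)$$ exhibits the cyclic sieving phenomenon, where $\langle\mathrm{rot}_n\rangle$ is regarded as an action of the cyclic group of order $n$.
   Context: Cyclic sieving: let $X$ be a finite set, $C_N$ a cyclic group of order $N$ with generator $g$ acting on $X$, and $f(q)$ a polynomial with non-negative integer coefficients. The triple $(X,C_N,f(q))$ exhibits the cyclic sieving phenomenon if for all $d\in\mathbb Z$, $|\{x\in X: g^d\cdot x=x\}|=f(\xi^d)$, where $\xi$ is a primitive $N$-th complex root of unity. $[m]_q=1+q+\dots+q^{m-1}$ (so $[0]_q=0$); $\begin{bmatrix} m\\ r\end{bmatrix}_q$ is the Gaussian $q$-binomial coefficient, equal to $0$ unless $m\ge r\ge 0$; $\mathbf{Cat}(m;q)=\frac{1}{[m+1]_q}\begin{bmatrix} 2m\\ m\end{bmatrix}_q$. A non-crossing $(1,2)$-configuration on $n$ vertices: place vertices $1,\dots,n$ around a circle; a configuration consists of a set of pairwise non-intersecting proper edges (chords joining two distinct vertices, pairwise non-crossing and not sharing endpoints)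 together with a set of loops, each loop placed on a vertex not incident to a proper edge (at most one loop per vertex). $\mathrm{NCC}^B(n+1)$ is the set of such configurations on $n$ vertices with the extra option that one of the proper edges may be marked (so there is either no marked proper edge or exactly one), and $\mathrm{NCC}^B(n+1,e,l)$ is the subset of those with exactly $e$ proper edges and $l$ loops. $\mathrm{rot}_n$ rotates by one step, $i\mapsto i+1\pmod n$, the marked edge being rotated as well. *)

(* Defs.v *)
From HB Require Import structures.
From mathcomp Require Import all_boot all_order all_algebra all_fingroup.
From mathcomp Require Import ring zify.

Set Implicit Arguments.
Unset Strict Implicit.
Unset Printing Implicit Defensive.

Import GRing.Theory Num.Theory.
Local Open Scope ring_scope.

(* q-analogues, as polynomials in q = 'X over int. *)

Definition qint (m : nat) : {poly int} := \sum_(i < m) 'X^i.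

Definition qfact (m : nat) : {poly int} := \prod_(i < m) qint i.+1.

(* The denominators in qbin and qCat are monic and the divisions are exact:
   see qbin_exact and qCat_exact. *)
Definition qbin (m r : nat) : {poly int} :=
  if (r <= m)%N then qfact m %/ (qfact r * qfact (m - r)) else 0.

Definition qCat (m : nat) : {poly int} := qbin (2 * m) m %/ qint m.+1.

(* For n < 2e the subtraction is truncated, but then qbin n (2 * e) = 0. *)
Definition Ncc (n e l : nat) : {poly int} :=
  'X^(e * (e + 1) + (n + 1) * l) * qbin n (2 * e) * qCat e * qbin (n - 2 * e) l.

Lemma qintS m : qint m.+1 = qint m + 'X^m.
Proof. by rewrite /qint big_ord_recr. Qed.

Lemma qintD m k : qint (m + k) = qint m + 'X^m * qint k.
Proof.
elim: k => [|k IH]; first by rewrite addn0 /qint big_ord0 mulr0 addr0.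
by rewrite addnS !qintS IH exprD; ring.
Qed.

Lemma qint_monic m : qint m.+1 \is monic.
Proof.
suff -> : qint m.+1 = \poly_(i < m.+1) 1.
  by rewrite monicE lead_coef_poly ?oner_eq0.
by rewrite poly_def; apply: eq_bigr => i _; rewrite scale1r.
Qed.

Lemma qfact_monic m : qfact m \is monic.
Proof. by apply: monic_prod => i _; apply: qint_monic. Qed.

Lemma qfactS m : qfact m.+1 = qfact m * qint m.+1.
Proof. by rewrite /qfact big_ord_recr. Qed.

Lemma mulpK_monic (p d : {poly int}) : d \is monic -> (p * d) %/ d = p.
Proof. by move=> /Pdiv.IdomainMonic.mulpK ->. Qed.

Lemma qfact_dvd r k : exists p : {poly int},
  qfact (r + k) = p * (qfact r * qfact k).
Proof.
move: {2}(r + k)%N (leqnn (r + k)) => m; elim: m r k => [|m IH] r k lerk.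
  by exists 1; move: lerk; case: r => // ; case: k => // _;
     rewrite addn0 /qfact !big_ord0 !mulr1.
case: r k lerk => [|r] [|k] lerk; try by exists 1;
  rewrite ?addn0 ?add0n /qfact ?big_ord0 ?mul1r ?mulr1.
have [p Ep] : exists p, qfact (r + k.+1) = p * (qfact r * qfact k.+1).
  by apply: IH; lia.
have [s Es] : exists s, qfact (r.+1 + k) = s * (qfact r.+1 * qfact k).
  by apply: IH; lia.
exists (p + 'X^(r.+1) * s).
rewrite addSn qfactS -addSn qintD mulrDr {1}Ep addnS -addSn Es !qfactS.
by ring.
Qed.

Lemma qbin_exact m r : (r <= m)%N ->
  qfact m = qbin m r * (qfact r * qfact (m - r)).
Proof.
move=> lerm; rewrite /qbin lerm; have [p] := qfact_dvd r (m - r).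
rewrite subnKC // => ->; rewrite mulpK_monic //.
by rewrite monicMl ?qfact_monic.
Qed.

Lemma qCat_exact m : qbin (2 * m) m = qCat m * qint m.+1.
Proof.
suff [p Ep] : exists p, qbin (2 * m) m = p * qint m.+1.
  by rewrite /qCat Ep mulpK_monic ?qint_monic.
case: m => [|m]; first by exists (qbin 0 0); rewrite qintS /qint big_ord0 add0r mulr1.
have lt1 : (m.+1 <= 2 * m.+1)%N by lia.
have lt2 : (m.+2 <= 2 * m.+1)%N by lia.
exists (qbin (2 * m.+1) m.+1 - 'X * qbin (2 * m.+1) m.+2).
have E1 := qbin_exact lt1; have E2 := qbin_exact lt2.
rewrite (_ : 2 * m.+1 - m.+1 = m.+1)%N in E1; last lia.
rewrite (_ : 2 * m.+1 - m.+2 = m)%N in E2; last lia.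
have nz : qfact m.+1 * qfact m != 0 by rewrite mulf_neq0 ?monic_neq0 ?qfact_monic.
have E : qbin (2 * m.+1) m.+2 * qint m.+2 = qbin (2 * m.+1) m.+1 * qint m.+1.
  apply: (mulIf nz); transitivity (qfact (2 * m.+1)).
    by rewrite E2 (qfactS m.+1); ring.
  by rewrite E1 (qfactS m); ring.
rewrite mulrBl -mulrA E -[m.+2]add1n qintD /qint big_ord1 expr0 expr1.
by rewrite -/(qint m.+1); ring.
Qed.

(* Cyclic sieving. *)

Definition expgz (gT : finGroupType) (g : gT) (d : int) : gT :=
  match d with Posz k => (g ^+ k)%g | Negz k => (g ^- k.+1)%g end.

(* The cyclic group is <[g]>, of order N; the last clause is asked of every
   primitive N-th root of unity in C, any model of the complex numbers. *)
Definition cyclic_sieving (C : numClosedFieldType) (N : nat)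
    (gT : finGroupType) (g : gT) (T : finType) (to : {action gT &-> T})
    (X : {set T}) (f : {poly int}) : Prop :=
  [/\ #[g]%g = N,
      [acts <[g]>%g, on X | to],
      forall i, 0 <= f`_i
    & forall xi : C, N.-primitive_root xi -> forall d : int,
        #|'Fix_(X | to)[expgz g d]%g|%:R = (map_poly intr f).[xi ^ d]].

(* Configurations on the vertices 'I_n, numbered from 0 around the circle. *)

Section Configurations.

Variable n : nat.

(* ((edges, loops), marked edge) *)
Definition config : finType :=
  ({set {set 'I_n}} * {set 'I_n} * option {set 'I_n})%type.

Definition edges (c : config) := c.1.1.
Definition loops (c : config) := c.1.2.
Definition marked (c : config) := c.2.

(* Two chords of a circle cross iff their endpoints interlace. *)
Definition crossing (A B : {set 'I_n}) : bool :=
  [exists a in A, exists b in A, exists c in B, exists d in B,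
    [&& (a < c)%N, (c < b)%N & (b < d)%N]].

Definition is_NCC (c : config) : bool :=
  [&& [forall A in edges c, #|A| == 2],
      trivIset (edges c),
      [forall A in edges c, forall B in edges c, ~~ crossing A B]
    & [disjoint loops c & cover (edges c)]].

Definition is_NCCB (c : config) : bool :=
  is_NCC c && (if marked c is Some A then A \in edges c else true).

Definition NCCB (e l : nat) : {set config} :=
  [set c | [&& is_NCCB c, #|edges c| == e & #|loops c| == l]].

Definition config_act (c : config) (s : {perm 'I_n}) : config :=
  ([set s @: A | A : {set 'I_n} in edges c], s @: loops c,
   omap (fun A : {set 'I_n} => s @: A) (marked c)).

Fact imset_perm1 (A : {set 'I_n}) : (1%g : {perm 'I_n}) @: A = A.
Proof. by rewrite -[RHS]imset_id; apply: eq_imset => x; rewrite perm1. Qed.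

Fact imset_permM (s t : {perm 'I_n}) (A : {set 'I_n}) :
  (s * t)%g @: A = t @: (s @: A).
Proof. by rewrite -imset_comp; apply: eq_imset => x; rewrite /= permM. Qed.

Fact config_act1 : config_act^~ 1%g =1 id.
Proof.
case=> [[E L] m]; rewrite /config_act /edges /loops /marked /= imset_perm1.
congr (_, _, _); last by case: m => //= A; rewrite imset_perm1.
by rewrite -[RHS]imset_id; apply: eq_imset => A; rewrite imset_perm1.
Qed.

Fact config_actM (c : config) (s t : {perm 'I_n}) :
  config_act c (s * t)%g = config_act (config_act c s) t.
Proof.
case: c => [[E L] m]; rewrite /config_act /edges /loops /marked /= imset_permM.
congr (_, _, _); last by case: m => //= A; rewrite imset_permM.
by rewrite -imset_comp; apply: eq_imset => A; rewrite /= imset_permM.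
Qed.

Definition config_action : {action {perm 'I_n} &-> config} :=
  TotalAction config_act1 config_actM.

(* i |-> i + 1 mod n; it has order n in the symmetric group when n >= 1, so
   the cyclic group of order n is the subgroup it generates. *)
Definition rot_perm : {perm 'I_n} := perm (@ordS_inj n).

End Configurations.

(* Main.v *)
Require Import Defs.
From mathcomp Require Import all_boot all_order all_algebra all_fingroup.
From mathcomp Require Import cyclic.
From mathcomp Require Import ring zify.

(** The exponent d only matters through the order o of xi^d, an o-th root of
    unity w with n = o * k: the powers rot^d and rot^k generate the same group
    and hence fix the same configurations.  So for each factorization
    n = o * k one has to evaluate the polynomial at w and to count the
    configurations invariant under the rotation by k.

    Algebra.  The q-Lucas theorem, in the case where the upper index is a
    multiple of o ([qev_qbin_mul]), turns every Gaussian binomial into an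
    ordinary one or into 0.  The polynomial takes the values
    - C(k,2p) C(2p,p) C(k-2p,l/o)        if e = o * p  ([qev_Ncc_dvd]),
    - 2 C(k,e) C(e,(e+1)/2) C(k-e,l/2)   if o = 2 and e is odd ([qev_Ncc_odd]),
    - 0                                  otherwise ([qev_Ncc_eq0]),
    where the first two are replaced by 0 when o does not divide l.

    Combinatorics.  An invariant configuration is encoded by a word of length k
    over four colours: opening bracket, closing bracket, loop, blank.  If o > 1,
    noncrossing forces each edge, with the exception of an invariant diameter,
    to have one arc shorter than k; that arc orients the edge from its opening
    to its closing end.  An invariant diameter exists only for o = 2, it is then
    unique, and both its ends are given the opening colour.  If o = 1 the edge
    is oriented from its smaller to its larger end.  Conversely, a k-periodic
    word is read as a mountain path: an opening bracket at height h closes at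
    the first return of the path to h, and the one bracket per period which
    never closes, when the path rises by 1 along a period, is joined to the
    opposite vertex.  The two constructions are inverse to each other
    ([wmatch_mword], [mword_wmatch]), so that invariant unmarked configurations
    are counted by words ([card_fixed_pairs]): all words with the right number
    of each colour if o > 1, those with a path that never goes below 0 if o = 1.

    Marks.  A configuration with a mark is invariant iff the marked edge is
    itself invariant.  For o = 1 there are 1 + e choices of mark or no mark, and
    1 + e times the Catalan number is the central binomial coefficient; for
    o > 1 only an invariant diameter can be marked, which gives the factor 2 in
    the second value above.

    Nonnegativity of the coefficients reduces to that of q-Catalan polynomials;
    these are special q-ballot polynomials, for which there is a recursion with
    nonnegative terms ([qballot_rec]). *)

Set Implicit Arguments.
Unset Strict Implicit.
Unset Printing Implicit Defensive.

Import Order.TTheory GRing.Theory Num.Theory.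
Local Open Scope ring_scope.

(** * Gaussian binomials *)

Lemma qfact_neq0 m : qfact m != 0.
Proof. by rewrite monic_neq0 ?qfact_monic. Qed.

Lemma qint_neq0 m : qint m.+1 != 0.
Proof. by rewrite monic_neq0 ?qint_monic. Qed.

Lemma qfact0 : qfact 0 = 1.
Proof. by rewrite /qfact big_ord0. Qed.

Lemma qbin_gt m r : (m < r)%N -> qbin m r = 0.
Proof. by move=> ltmr; rewrite /qbin leqNgt ltmr. Qed.

Lemma qbin0 m : qbin m 0 = 1.
Proof.
have := qbin_exact (leq0n m); rewrite subn0 qfact0 mul1r -{1}[qfact m]mul1r.
by move/(mulIf (qfact_neq0 m)).
Qed.

Lemma qbinn m : qbin m m = 1.
Proof.
have := qbin_exact (leqnn m); rewrite subnn qfact0 mulr1 -{1}[qfact m]mul1r.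
by move/(mulIf (qfact_neq0 m)).
Qed.

Lemma qbinS m r : qbin m.+1 r.+1 = qbin m r + 'X^(r.+1) * qbin m r.+1.
Proof.
have [ltmr|ltrm|->] := ltngtP m r.
- by rewrite (@qbin_gt m.+1) ?(@qbin_gt m r) ?(@qbin_gt m r.+1) ?mulr0 ?addr0 //; lia.
- have E1 : (m.+1 - r.+1 = (m - r.+1).+1)%N by lia.
  have := @qbin_exact m.+1 r.+1 (ltnW ltrm).
  have := @qbin_exact m r (ltnW ltrm); have := @qbin_exact m r.+1 ltrm.
  rewrite (_ : m - r = (m - r.+1).+1)%N; last lia.
  rewrite E1 !qfactS; set k := (m - r.+1)%N => Ea Eb Ec.
  have nz : qfact r * qint r.+1 * (qfact k * qint k.+1) != 0.
    by rewrite !mulf_neq0 ?qfact_neq0 ?qint_neq0.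
  apply: (mulIf nz); rewrite -Ec mulrDl.
  have -> : m.+1 = (r.+1 + k.+1)%N by rewrite /k; lia.
  rewrite qintD mulrDr {1}Eb Ea; ring.
- by rewrite !qbinn qbin_gt ?mulr0 ?addr0.
Qed.

Lemma qbin_absorb_low a b :
  qbin (a + b).+1 b.+1 * qint b.+1 = qbin (a + b).+1 b * qint a.+1.
Proof.
have le1 : (b.+1 <= (a + b).+1)%N by lia.
have le2 : (b <= (a + b).+1)%N by lia.
have := qbin_exact le1; have := qbin_exact le2.
rewrite (_ : (a + b).+1 - b = a.+1)%N; last lia.
rewrite (_ : (a + b).+1 - b.+1 = a)%N; last lia.
have nz : qfact a * qfact b != 0 by rewrite mulf_neq0 ?qfact_neq0.
rewrite [qfact b.+1]qfactS [qfact a.+1]qfactS => -> E; apply: (mulIf nz).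
by transitivity (qbin (a + b).+1 b * (qfact b * (qfact a * qint a.+1))); [rewrite E|]; ring.
Qed.

Lemma qbin_absorb_high a b :
  qbin (a + b).+1 b * qint a.+1 = qbin (a + b) b * qint (a + b).+1.
Proof.
have le1 : (b <= (a + b).+1)%N by lia.
have le2 : (b <= a + b)%N by lia.
have := qbin_exact le1; have := qbin_exact le2.
rewrite (_ : (a + b).+1 - b = a.+1)%N; last lia.
rewrite (_ : (a + b) - b = a)%N; last lia.
have nz : qfact a * qfact b != 0 by rewrite mulf_neq0 ?qfact_neq0.
rewrite qfactS [qfact a.+1]qfactS => -> E; apply: (mulIf nz).
by transitivity (qbin (a + b).+1 b * (qfact b * (qfact a * qint a.+1))); [|rewrite -E]; ring.
Qed.

(** The mirror image of [qbinS] under r <-> m - r. *)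
Lemma qbinS_high a b : qbin (a + b).+1 b.+1 = qbin (a + b) b.+1 + 'X^a * qbin (a + b) b.
Proof.
case: a => [|a].
  by rewrite add0n expr0 mul1r qbinn [qbin b b.+1]qbin_gt // qbinn add0r.
apply: (mulIf (qint_neq0 b)); rewrite mulrDl.
rewrite [X in _ = X + _](_ : _ = qbin (a.+1 + b) b * qint a.+1); last first.
  by rewrite addSn qbin_absorb_low.
rewrite qbin_absorb_low qbin_absorb_high -addnS qintD; ring.
Qed.

(** * Nonnegativity of the coefficients *)

Definition coef_ge0 (p : {poly int}) := forall i, 0 <= p`_i.

Lemma coef_ge0D p q : coef_ge0 p -> coef_ge0 q -> coef_ge0 (p + q).
Proof. by move=> p0 q0 i; rewrite coefD addr_ge0. Qed.

Lemma coef_ge0M p q : coef_ge0 p -> coef_ge0 q -> coef_ge0 (p * q).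
Proof.
by move=> p0 q0 i; rewrite coefM; apply: sumr_ge0 => j _; rewrite mulr_ge0.
Qed.

Lemma coef_ge0Xn m : coef_ge0 'X^m.
Proof. by move=> i; rewrite coefXn ler0n. Qed.

Lemma coef_ge00 : coef_ge0 0.
Proof. by move=> i; rewrite coef0. Qed.

Lemma coef_ge01 : coef_ge0 1.
Proof. by move=> i; rewrite coef1 ler0n. Qed.

Lemma coef_ge0_qint m : coef_ge0 (qint m).
Proof.
elim: m => [|m IH]; first by rewrite /qint big_ord0; apply: coef_ge00.
by rewrite qintS; apply: coef_ge0D IH (coef_ge0Xn _).
Qed.

Lemma coef_ge0_qbin m r : coef_ge0 (qbin m r).
Proof.
elim: m r => [|m IH] [|r]; try by rewrite qbin0; apply: coef_ge01.
  by rewrite qbin_gt //; apply: coef_ge00.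
by rewrite qbinS; apply/coef_ge0D/coef_ge0M => //; apply: coef_ge0Xn.
Qed.

Lemma qintX m : (1 - 'X) * qint m = 1 - 'X^m.
Proof.
elim: m => [|m IH]; first by rewrite /qint big_ord0; ring.
by rewrite qintS mulrDr IH exprS; ring.
Qed.

Definition qbin_pred (m r : nat) : {poly int} := if r is r'.+1 then qbin m r' else 0.

(** Up to the factor q^b, the generating polynomial of the standard tableaux of
    shape (a, b) by major index; [qbin_pred] only serves to give the value 0 to
    the binomial with lower index -1. *)
Definition qballot (a b : nat) : {poly int} :=
  qbin (a + b) b - 'X^(a.+1 - b) * qbin_pred (a + b) b.

Lemma qballot0 a : qballot a 0 = 1.
Proof. by rewrite /qballot qbin0 mulr0 subr0. Qed.

Lemma qballot_lt b : qballot b b.+1 = 0.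
Proof.
rewrite /qballot subnn expr0 mul1r /= addnS.
apply: (mulIf (qint_neq0 b)); rewrite mul0r mulrBl qbin_absorb_low; ring.
Qed.

Lemma qbin_absorbX_high a b :
  (1 - 'X^(a.+1)) * qbin (a + b).+1 b = (1 - 'X^((a + b).+1)) * qbin (a + b) b.
Proof.
rewrite -!qintX -!mulrA; congr (_ * _).
by rewrite mulrC qbin_absorb_high mulrC.
Qed.

Lemma qbin_absorbX_low a b :
  (1 - 'X^(b.+1)) * qbin (a + b).+1 b.+1 = (1 - 'X^((a + b).+1)) * qbin (a + b) b.
Proof.
rewrite -!qintX -!mulrA; congr (_ * _).
by rewrite mulrC qbin_absorb_low qbin_absorb_high mulrC.
Qed.

(** Remove the largest entry n of a tableau of shape (a+1, b+1).  If it is in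
    the second row, the position of n - 1 tells whether n - 1 is a descent:
    the difference on the left counts the tableaux with n in the second row,
    the two terms on the right split them by the row of n - 1.  The proof
    checks the identity on binomials. *)
Lemma qballot_rec a b : (b <= a)%N ->
  'X * (qballot a.+1 b.+1 - qballot a b.+1) =
  (qballot a.+1 b - qballot a b) + 'X^((a + b).+1) * qballot a b.
Proof.
move=> leba; rewrite /qballot /=.
rewrite (_ : a.+2 - b.+1 = (a - b).+1)%N; last lia.
rewrite (_ : a.+1 - b.+1 = a - b)%N; last lia.
rewrite (_ : a.+2 - b = (a - b).+2)%N; last lia.
rewrite (_ : a.+1 - b = (a - b).+1)%N; last lia.
rewrite !(addSn, addnS).
have E1 := qbinS_high a.+1 b; rewrite addSn in E1.
have E2 := qbin_absorbX_high a b.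
have Ea : 'X^a = 'X^(a - b) * 'X^b :> {poly int} by rewrite -exprD subnK.
(* the contribution of the subtracted binomials, by itself a multiple of 1 - q *)
have E : 'X * 'X^(a - b) * ('X * qbin (a + b).+2 b - qbin (a + b).+1 b
  - 'X * qbin_pred (a + b).+1 b + (1 - 'X^((a + b).+1)) * qbin_pred (a + b) b)
  = - 'X * 'X^a * (1 - 'X) * qbin (a + b).+1 b :> {poly int}.
  rewrite Ea; case: b {leba E1 E2 Ea} => [|b] /=.
    by rewrite !qbin0 subn0 expr0; ring.
  rewrite qbinS addnS; have := qbin_absorbX_low a.+1 b; rewrite !addSn => E3.
  rewrite -E3 !exprS; ring.
transitivity (- 'X * 'X^a * (1 - 'X) * qbin (a + b).+1 b +
  (qbin (a + b).+1 b - (1 - 'X^((a + b).+1)) * qbin (a + b) b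
   - 'X * 'X^(a - b) * ('X * qbin_pred (a + b).+1 b - (1 - 'X^((a + b).+1)) * qbin_pred (a + b) b))
   - 'X * 'X^(a - b) * ('X * qbin (a + b).+2 b - qbin (a + b).+1 b
  - 'X * qbin_pred (a + b).+1 b + (1 - 'X^((a + b).+1)) * qbin_pred (a + b) b)).
  rewrite -E2 E1 !exprS; ring.
by rewrite E !exprS; ring.
Qed.

Lemma coef_ge0_Xdiv p : coef_ge0 ('X * p) -> coef_ge0 p.
Proof. by move=> p0 i; have := p0 i.+1; rewrite coefXM. Qed.

(** The induction needs the differences [qballot a b - qballot (a-1) b] as
    well: in [qballot_rec] it is these that are obtained from b to b + 1, and
    the polynomials themselves follow by summing over a. *)
Lemma coef_ge0_qballot a b : (b <= a.+1)%N -> coef_ge0 (qballot a b).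
Proof.
suff: (b <= a.+1)%N -> coef_ge0 (qballot a b) /\
    ((b <= a)%N -> forall a', a = a'.+1 -> coef_ge0 (qballot a b - qballot a' b)).
  by move=> H /H [].
elim: b a => [|b IHb] a; first by rewrite qballot0; split=> [|_ a' _];
  rewrite ?qballot0 ?subrr; [exact: coef_ge01 | exact: coef_ge00].
have G a' : (b <= a')%N -> coef_ge0 (qballot a'.+1 b.+1 - qballot a' b.+1).
  move=> leba; apply: coef_ge0_Xdiv; rewrite qballot_rec //.
  apply: coef_ge0D.
    by have [|_] := IHb a'.+1; [lia|apply=> //; lia].
  by apply: coef_ge0M (coef_ge0Xn _) _; have [|] := IHb a'; [lia|].
move=> leba; split=> [|leb a' Ea]; last by rewrite Ea; apply: G; lia.
elim: a leba => [|a IHa] leba.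
  have -> : b = 0%N by lia.
  by rewrite qballot_lt; apply: coef_ge00.
have [->|neq] := eqVneq b a.+1; first by rewrite qballot_lt; apply: coef_ge00.
rewrite -[qballot a.+1 _](subrK (qballot a b.+1)).
by apply: coef_ge0D; [apply: G|apply: IHa]; lia.
Qed.

Lemma qCat_ballot m : qCat m = qballot m m.
Proof.
apply: (mulIf (qint_neq0 m)); rewrite -qCat_exact /qballot mul2n -addnn.
case: m => [|m] /=; first by rewrite mulr0 subr0 /qint big_ord1 expr0 mulr1.
rewrite (_ : m.+2 - m.+1 = 1)%N; last lia.
have E := qbin_absorb_low m.+1 m.
rewrite addSn addnS mulrBl -mulrA -addSn -E -[m.+2]add1n qintD /qint big_ord1.
rewrite -/(qint m.+1) expr0 expr1; ring.
Qed.

Lemma coef_ge0_qCat m : coef_ge0 (qCat m).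
Proof. by rewrite qCat_ballot; apply: coef_ge0_qballot. Qed.

Lemma coef_ge0_Ncc n e l : coef_ge0 ((1 + qint e) * Ncc n e l).
Proof.
apply: coef_ge0M; first exact: coef_ge0D coef_ge01 (coef_ge0_qint _).
apply: coef_ge0M (coef_ge0_qbin _ _); apply: coef_ge0M (coef_ge0_qCat _).
exact: coef_ge0M (coef_ge0Xn _) (coef_ge0_qbin _ _).
Qed.

(** * Values at roots of unity *)

Section RootOfUnity.

Variables (F : numFieldType) (o : nat) (w : F).
Hypothesis prim_w : o.-primitive_root w.

Let o_gt0 : (0 < o)%N := prim_order_gt0 prim_w.

Definition qev (p : {poly int}) : F := (map_poly intr p).[w].

Lemma qevD p q : qev (p + q) = qev p + qev q.
Proof. by rewrite /qev rmorphD hornerD. Qed.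
Lemma qevM p q : qev (p * q) = qev p * qev q.
Proof. by rewrite /qev rmorphM hornerM. Qed.
Lemma qev0 : qev 0 = 0.
Proof. by rewrite /qev rmorph0 horner0. Qed.
Lemma qev1 : qev 1 = 1.
Proof. by rewrite /qev rmorph1 hornerC. Qed.
Lemma qevXn m : qev 'X^m = w ^+ m.
Proof. by rewrite /qev map_polyXn hornerXn. Qed.

Lemma qev_qintM m : (1 - w) * qev (qint m) = 1 - w ^+ m.
Proof.
have := congr1 qev (qintX m); rewrite qevM.
have E k : qev (1 - 'X^k) = 1 - w ^+ k.
  by rewrite /qev rmorphB rmorph1 /= map_polyXn hornerD hornerN hornerXn hornerC.
by rewrite E -['X]expr1 E expr1.
Qed.

Lemma qev_qint1 : o = 1%N -> forall m, qev (qint m) = m%:R.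
Proof.
move=> o1 m; have w1 : w = 1 by have := prim_expr_order prim_w; rewrite o1 expr1.
elim: m => [|m IH]; first by rewrite /qint big_ord0 qev0.
by rewrite qintS qevD IH qevXn w1 expr1n -natr1.
Qed.

Lemma prim_root_neq1 : (1 < o)%N -> 1 - w != 0.
Proof.
move=> o1; rewrite subr_eq0 eq_sym -[w]expr1 -(prim_order_dvd prim_w) dvdn1.
by rewrite neq_ltn o1 orbT.
Qed.

Lemma qev_qint_dvd m : (1 < o)%N -> (o %| m)%N -> qev (qint m) = 0.
Proof.
move=> o1 dvd; apply: (mulfI (prim_root_neq1 o1)); rewrite qev_qintM mulr0.
by move: dvd; rewrite (prim_order_dvd prim_w) => /eqP ->; rewrite subrr.
Qed.

Lemma qev_qint_ndvd m : ~~ (o %| m)%N -> qev (qint m) != 0.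
Proof.
apply: contraNneq => E; have := qev_qintM m; rewrite E mulr0 => /esym/eqP.
by rewrite subr_eq0 eq_sym (prim_order_dvd prim_w).
Qed.

Lemma qev_qintS_dvd m : (1 < o)%N -> (o %| m)%N -> qev (qint m.+1) = 1.
Proof.
move=> o1 dvd; rewrite qintS qevD qev_qint_dvd // qevXn add0r.
by apply/eqP; rewrite -(prim_order_dvd prim_w).
Qed.

Lemma qev_qfact_neq0 m : (m < o)%N -> qev (qfact m) != 0.
Proof.
elim: m => [|m IH] ltmo; first by rewrite qfact0 qev1 oner_neq0.
rewrite qfactS qevM mulf_neq0 ?IH 1?ltnW //; apply: qev_qint_ndvd.
by rewrite gtnNdvd.
Qed.

Lemma qev_qbin_order r : (0 < r < o)%N -> qev (qbin o r) = 0.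
Proof.
case/andP=> r0 ro; have := congr1 qev (qbin_exact (ltnW ro)).
have -> : qev (qfact o) = 0.
  by rewrite -{1}(prednK o_gt0) qfactS qevM prednK // qev_qint_dvd ?mulr0 //; lia.
rewrite !qevM => /esym/eqP; rewrite !mulf_eq0 => /orP[/eqP-> //|].
by rewrite (negPf (qev_qfact_neq0 ro)) (negPf (qev_qfact_neq0 _)) //; lia.
Qed.

(** At a primitive o-th root of unity the row o of the q-Pascal triangle
    consists of zeros between two ones; since w^o = 1, the rows below it obey
    the same rule as the rows below row 0, hence the superposition. *)
Lemma qev_qbinDorder M r :
  qev (qbin (M + o) r) =
  qev (qbin M r) + (if (o <= r)%N then qev (qbin M (r - o)) else 0).
Proof.
elim: M r => [|M IH] [|r].
- by rewrite !qbin0 leqNgt o_gt0 addr0.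
- rewrite add0n [qbin 0 _]qbin_gt // qev0 add0r.
  have [lt|gt|->] := ltngtP o r.+1.
  + by rewrite !qbin_gt ?qev0 //; lia.
  + by rewrite qev_qbin_order ?gt.
  + by rewrite subnn qbin0 qbinn.
- by rewrite !qbin0 leqNgt o_gt0 addr0.
rewrite addSn !qbinS !qevD !qevM !IH qevXn.
have [le|lt|eq] := ltngtP o r.+1.
- rewrite ltnS in le; rewrite le subSn // qbinS qevD qevM qevXn.
  have -> : w ^+ r.+1 = w ^+ (r - o).+1.
    by rewrite -subSn // -[in LHS](subnK (leqW le)) exprD (prim_expr_order prim_w) mulr1.
  ring.
- by rewrite leqNgt (ltnW lt) /=; ring.
- rewrite leqNgt -eq leqnn /= eq subnn !qbin0 -eq (prim_expr_order prim_w) qev1; ring.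
Qed.

(** The q-Lucas theorem for an upper index divisible by o. *)
Lemma qev_qbin_mul k r :
  qev (qbin (o * k) r) = if (o %| r)%N then 'C(k, r %/ o)%:R else 0.
Proof.
elim: k r => [|k IH] r.
  rewrite muln0; case: r => [|r]; first by rewrite qbin0 qev1 dvdn0 div0n bin0.
  rewrite qbin_gt // qev0; case: ifP => // /dvdnP[[|q] E] //.
  by rewrite E mulnK // bin0n.
rewrite mulnS addnC qev_qbinDorder !IH.
have [le|lt] := leqP o r; last first.
  rewrite addr0 divn_small // !bin0; case: ifP => //.
rewrite dvdn_subl //; case: ifP => [/dvdnP[q E]|]; last by rewrite addr0.
have -> : (r - o = q.-1 * o)%N by rewrite E -subn1 mulnBl mul1n.
rewrite E !mulnK //.
case: q E => [|q] E; first by rewrite E mul0n leqn0 -[o == _]negbK -lt0n o_gt0 in le.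
by rewrite binS natrD.
Qed.

(** A second expression of the q-Catalan polynomial, whose denominator does not
    vanish at -1 when m is odd, in contrast to the one of [qCat_exact]. *)
Lemma qCat_exact_pred m : qCat m * qint m = qbin (2 * m) m.+1.
Proof.
apply: (mulIf (qint_neq0 m)); rewrite mulrAC -qCat_exact.
case: m => [|m]; first by rewrite /qint big_ord0 mulr0 qbin_gt ?mul0r.
by rewrite (_ : (2 * m.+1 = (m + m.+1).+1)%N) ?qbin_absorb_low //; lia.
Qed.

Lemma qev_qCat_ndvd e : (o %| 2 * e)%N -> ~~ (o %| e)%N -> o != 2%N -> qev (qCat e) = 0.
Proof.
move=> d2 nd no2; have := congr1 qev (qCat_exact e).
case/dvdnP: (d2) => k ->; rewrite mulnC qev_qbin_mul (negPf nd) qevM.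
move/esym/eqP; rewrite mulf_eq0 => /orP[/eqP //|]; rewrite (negPf (qev_qint_ndvd _)) //.
apply: contra no2 => d1; have : (o %| 2)%N.
  by rewrite -(dvdn_addr _ d2) (_ : 2 * e + 2 = 2 * e.+1)%N ?dvdn_mull //; lia.
rewrite dvdn_divisors //= !inE => /orP[/eqP o1|//].
by rewrite o1 dvd1n in nd.
Qed.

(** For o = 1 this is the factor 1 + e that cancels the denominator of the
    Catalan number; for o > 1 both [qint e] + 1 and the denominator are 1. *)
Lemma qev_1qintM_qCat e : (o %| e)%N ->
  qev ((1 + qint e) * qCat e) = 'C(2 * (e %/ o), e %/ o)%:R.
Proof.
case/dvdnP=> p ->; rewrite mulnK // mulnC.
have E := congr1 qev (qCat_exact (o * p)).
rewrite mulnCA qev_qbin_mul dvdn_mulr // mulKn // in E.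
rewrite E !qevM qevD qev1 mulrC; congr (_ * _).
have [o1|o1] := eqVneq o 1%N; first by rewrite !qev_qint1 // nat1r.
have {}o1 : (1 < o)%N by rewrite ltn_neqAle eq_sym o1.
by rewrite qev_qint_dvd ?qev_qintS_dvd ?dvdn_mulr // addr0.
Qed.

(** Here the exponent of the power of q is a multiple of o whenever o divides l. *)
Lemma qev_Ncc_dvd k p l :
  qev ((1 + qint (o * p)) * Ncc (o * k) (o * p) l) =
  if (o %| l)%N then
    ('C(k, 2 * p) * 'C(2 * p, p) * 'C(k - 2 * p, l %/ o))%:R else 0.
Proof.
rewrite /Ncc.
set X := 'X^_; set B1 := qbin _ _; set B2 := qbin _ _.
have -> : (1 + qint (o * p)) * (X * B1 * qCat (o * p) * B2) =
  X * B1 * ((1 + qint (o * p)) * qCat (o * p)) * B2 by ring.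
rewrite qevM qevM (qev_1qintM_qCat (dvdn_mulr _ (dvdnn o))) mulKn //.
rewrite /B2 mulnCA -mulnBr qev_qbin_mul; case: ifP => dl; last by rewrite mulr0.
rewrite /X /B1 qevM qevXn mulnCA qev_qbin_mul dvdn_mulr // mulKn // !natrM.
congr (_ * _ * _); rewrite -[RHS]mul1r; congr (_ * _).
apply/eqP; rewrite -(prim_order_dvd prim_w) dvdn_add //; last exact: dvdn_mull.
by rewrite -mulnA dvdn_mulr.
Qed.

Lemma qev_Ncc_odd k e l : o = 2%N -> odd e ->
  qev ((1 + qint e) * Ncc (o * k) e l) =
  if (o %| l)%N then (2 * ('C(k, e) * 'C(e, (e.+1)./2) * 'C(k - e, l %/ o)))%:R else 0.
Proof.
move=> o2 odde; rewrite /Ncc !qevM qevD qev1 qevXn.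
have Ee : e = (e.-1./2).*2.+1 by lia.
have e1 : qev (qint e) = 1.
  by rewrite Ee qev_qintS_dvd // o2 // dvdn2 odd_double.
have := congr1 qev (qCat_exact_pred e); rewrite qevM e1 mulr1 => ->.
have E2 : (2 * e = o * e)%N by rewrite o2.
rewrite E2 -mulnBr !qev_qbin_mul dvdn_mulr // mulKn //.
have -> : (o %| e.+1)%N by rewrite o2 dvdn2 /= odde.
case: ifP => dl; last by rewrite !mulr0.
rewrite (_ : e.+1 %/ o = e.+1./2)%N; last by rewrite o2 divn2.
suff -> : w ^+ (e * (e + 1) + (o * k + 1) * l) = 1 by rewrite !natrM; ring.
apply/eqP; rewrite -(prim_order_dvd prim_w) dvdn_add // dvdn_mull //.
by rewrite o2 dvdn2 oddD odde.
Qed.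

Lemma qev_Ncc_eq0 k e l : ~~ (o %| e)%N -> ~~ ((o == 2%N) && odd e) ->
  qev ((1 + qint e) * Ncc (o * k) e l) = 0.
Proof.
move=> nd; rewrite negb_and => no; rewrite /Ncc !qevM qev_qbin_mul.
case: ifP => d2; last by rewrite mulr0 !mul0r mulr0.
suff -> : qev (qCat e) = 0 by rewrite mulr0 mul0r mulr0.
apply: qev_qCat_ndvd => //; case/orP: no => // ev; apply: contra nd => /eqP ->.
by rewrite dvdn2.
Qed.

End RootOfUnity.

(** * Periodic words and their brackets *)

Definition color : finType := option (option bool).
(* opening bracket, closing bracket, loop, blank *)
Notation Op := (Some (Some true) : color).
Notation Cl := (Some (Some false) : color).
Notation Lp := (Some None : color).
Notation Bl := (None : color).

Definition step (c : color) : int := if c is Some (Some b) then (if b then 1 else -1) else 0.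

Definition height (w : nat -> color) (i : nat) : int := \sum_(t < i) step (w t).

Lemma heightS w i : height w i.+1 = height w i + step (w i).
Proof. by rewrite /height big_ord_recr. Qed.

(** The drift D is the rise of the path along a period: 0 if all brackets are
    matched, 1 if one opening bracket per period is not. *)
Record periodic_word (k : nat) (w : nat -> color) (D : nat) : Prop := PeriodicWord {
  pw_gt0 : (0 < k)%N;
  pw_per : forall i, w (i + k)%N = w i;
  pw_drift : height w k = D;
  pw_drift_le1 : (D <= 1)%N }.

Section PeriodicWord.

Variables (k : nat) (w : nat -> color) (D : nat).
Hypothesis pw : periodic_word k w D.
Let k_gt0 := pw_gt0 pw.
Let w_per := pw_per pw.
Let h_drift := pw_drift pw.
Let D_le1 := pw_drift_le1 pw.
Notation h := (height w).

Lemma height_per i : h (i + k)%N = h i + D.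
Proof.
elim: i => [|i IH]; first by rewrite add0n h_drift /height big_ord0 add0r.
by rewrite addSn !heightS IH w_per; lia.
Qed.

(** The first return to the height of i.  The search stops before i + k, and
    [find] returns the length of the list when it fails, so that a bracket that
    never closes is sent to i + k, the opposite vertex when n = 2 k. *)
Definition close (i : nat) : nat :=
  i + (find (fun t => h (i + t.+1).+1 <= h i) (iota 0 k.-1)).+1.

Lemma close_bounds i : (i < close i <= i + k)%N.
Proof.
rewrite /close -{1}[i]addn0 ltn_add2l ltnS leq0n leq_add2l /=.
have := find_size (fun t => h (i + t.+1).+1 <= h i) (iota 0 k.-1).
by rewrite size_iota; lia.
Qed.

Lemma close_above i x : w i = Op -> (i < x <= close i)%N -> h i < h x.
Proof.
move=> wi; case/andP=> ltix; have -> : x = (i + (x - i.+1)).+1 by lia.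
case: (x - i.+1)%N => [|s]; first by rewrite addn0 heightS wi /=; lia.
rewrite -addnS /close leq_add2l ltnS => lt.
have ltk : (s < k.-1)%N.
  have := find_size (fun t => h (i + t.+1).+1 <= h i) (iota 0 k.-1).
  by rewrite size_iota; apply: leq_trans.
by have := before_find 0%N lt; rewrite nth_iota // add0n -addnS => /negbT; rewrite -ltNge.
Qed.

Lemma close_matched i : w i = Op -> (close i < i + k)%N ->
  h (close i).+1 = h i /\ w (close i) = Cl.
Proof.
move=> wi lt.
have : has (fun t => h (i + t.+1).+1 <= h i) (iota 0 k.-1).
  by rewrite has_find size_iota; move: lt; rewrite /close; set t := find _ _; lia.
move/(nth_find 0%N); set t := find _ _.
have tlt : (t < k.-1)%N by move: lt; rewrite /close -/t; lia.
rewrite nth_iota // add0n => le.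
have cE : close i = (i + t.+1)%N by [].
have := @close_above i (close i) wi; have := close_bounds i.
move: le; rewrite -cE heightS => le /andP[-> _]; rewrite leqnn => /(_ isT).
by move: le; case: (w (close i)) => [[[]|]|] /= ? ?; split=> //; lia.
Qed.

Lemma close_unmatched i : w i = Op -> close i = (i + k)%N -> D = 1%N.
Proof.
move=> wi ci; have : h i < h (i + k)%N.
  by apply: close_above => //; rewrite -ci leqnn; case/andP: (close_bounds i) => ->.
by rewrite height_per; lia.
Qed.

Lemma closeE i j : w i = Op -> (i < j < i + k)%N -> h j.+1 <= h i ->
  (forall x, (i < x <= j)%N -> h i < h x) -> close i = j.
Proof.
move=> wi /andP[ltij ltjk] le up; have [ltc|ltc|//] := ltngtP (close i) j.
  have [E _] := close_matched wi (ltn_trans ltc ltjk).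
  have := up (close i).+1; rewrite E ltxx ltnS ltc andbT => /(_ _).
  by case/andP: (close_bounds i) => /ltnW -> _ /(_ isT).
by have := @close_above i j.+1 wi; rewrite ltc andbT => /(_ (leqW ltij)); lia.
Qed.

Lemma close_per i : close (i + k) = (close i + k)%N.
Proof.
rewrite /close addnAC; congr (_ + _.+1 + _)%N; apply: eq_find => t.
rewrite (_ : (i + k + t.+1).+1 = (i + t.+1).+1 + k)%N; last lia.
by rewrite !height_per lerD2r.
Qed.

Lemma word_perM i q : w (i + q * k) = w i.
Proof. by elim: q => [|q IH]; rewrite ?addn0 // mulSnr addnA w_per. Qed.

Lemma close_perM i q : close (i + q * k) = (close i + q * k)%N.
Proof. by elim: q => [|q IH]; rewrite ?addn0 // mulSnr !addnA close_per IH. Qed.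

(** If i < j closed at the same place, the path would return to the height of i
    at that place, although it is strictly above this height at j. *)
Lemma close_inj i j : w i = Op -> w j = Op ->
  (close i < i + k)%N -> (close j < j + k)%N -> close i = close j -> i = j.
Proof.
wlog ltij : i j / (i < j)%N.
  move=> W wi wj ci cj E; have [lt|lt|//] := ltngtP i j; first exact: W.
  exact/esym/W.
move=> wi wj ci cj E; have [Ei _] := close_matched wi ci.
have [Ej _] := close_matched wj cj.
have := @close_above i j wi; rewrite ltij -Ei E Ej ltxx -E.
by rewrite E; case/andP: (close_bounds j) => /ltnW -> _ /(_ isT).
Qed.

(** The path comes down to the height of i, below that of s, before s closes.
    If i never closes, it is at i + k that the path is too low: it is only D <= 1
    above the height of i. *)
Lemma close_noncross i s : w i = Op -> w s = Op ->
  (i < s)%N -> (s < close i)%N -> (close i < close s)%N -> False.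
Proof.
move=> wi ws ltis lts ltc.
have lt1 : h i < h s by apply: close_above => //; rewrite ltis ltnW.
have [ci|ci] := ltnP (close i) (i + k).
  have [E _] := close_matched wi ci.
  have : h s < h (close i).+1 by apply: close_above => //; lia.
  by lia.
have E : close i = (i + k)%N by have := close_bounds i; lia.
have : h s < h (close i) by apply: close_above => //; lia.
by rewrite E height_per; lia.
Qed.

(** The opening bracket is the last position before j where the path is not
    above its height after j; the bound [k <= j] guarantees that there is one
    within a period, since the path does not descend along a period. *)
Lemma close_onto j : w j = Cl -> (k <= j)%N ->
  exists i, [/\ w i = Op, close i = j & (i < j < i + k)%N].
Proof.
move=> wj lekj; have hj : h j = h j.+1 + 1 by rewrite heightS wj /=; lia.
pose P t := (t < j)%N && (h t <= h j.+1).
have E : h j.+1 = h (j.+1 - k)%N + D by rewrite -height_per subnK // leqW.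
have P0 : P (j.+1 - k)%N.
  rewrite /P E lerDl andbT ltn_subLR ?(leqW lekj) //.
  suff : k != 1%N by lia.
  by apply/eqP=> k1; move: E; rewrite k1 subn1 /= hj; lia.
have Pb t : P t -> (t <= j)%N by case/andP=> /ltnW.
case: (ex_maxnP (ex_intro (fun t => P t) _ P0) Pb) => i /andP[ltij le] imax.
have up x : (i < x <= j)%N -> h j.+1 < h x.
  case/andP=> ltix; rewrite leq_eqVlt => /orP[/eqP->|ltxj]; first by rewrite hj; lia.
  by rewrite ltNge; apply/negP=> lex; have := imax x; rewrite /P ltxj lex => /(_ isT); lia.
have := up i.+1; rewrite ltnSn ltij (heightS w i) => /(_ isT) lt.
have wi : w i = Op by move: lt; case: (w i) => [[[]|]|] //=; lia.
have lek := imax _ P0.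
exists i; split=> //; last by lia.
apply: closeE => //; [by lia|by move: lt; rewrite wi /=; lia|].
by move=> x /up; lia.
Qed.

Lemma ballot_close i : D = 0%N -> (forall t, (t <= k)%N -> 0 <= h t) ->
  w i = Op -> (i < k)%N -> (close i < k)%N.
Proof.
move=> D0 bal wi ltik; rewrite ltnNge; apply/negP=> le.
have : h i < h k by apply: close_above => //; rewrite ltik.
by have := bal i (ltnW ltik); rewrite h_drift D0; lia.
Qed.

End PeriodicWord.

(** * Noncrossing matchings of the circle *)

Lemma eqmod_addn x y n : x = y %[mod n] -> (x <= y)%N -> exists q, y = (x + q * n)%N.
Proof.
move=> E le; exists (y %/ n - x %/ n)%N.
by rewrite {1}(divn_eq y n) {1}(divn_eq x n) E addnAC -mulnDl subnKC // leq_div2r.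
Qed.

Lemma eqmod_window x y z n : x = y %[mod n] ->
  (z <= x < z + n)%N -> (z <= y < z + n)%N -> x = y.
Proof.
wlog le : x y / (x <= y)%N => [W|] E bx bz.
  by have [le|/ltnW le] := leqP x y; [apply: W|apply/esym/W].
have [[|q] Eq] := eqmod_addn E le; first by rewrite Eq addn0.
by move: bx bz; rewrite Eq mulSn; lia.
Qed.

(** A partial noncrossing matching of n points on a circle, invariant under the
    rotation by k, as a relation on integer positions read modulo n.  Working
    with all lifts to nat makes noncrossing a statement on four increasing
    integers in a window of length n, without wrap-around. *)
Record matching (n k : nat) (M : nat -> nat -> bool) : Prop := Matching {
  m_sym : forall i j, M i j = M j i;
  m_mod : forall i i' j, i = i' %[mod n] -> M i j = M i' j;
  m_inv : forall i j, M (i + k)%N (j + k)%N = M i j;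
  m_irr : forall i j, M i j -> i <> j %[mod n];
  m_uniq : forall i j j', M i j -> M i j' -> j = j' %[mod n];
  m_nc : forall i j s t, (i < s)%N -> (s < j)%N -> (j < t)%N -> (t < i + n)%N ->
    M i j -> M s t -> False }.

(** The matching of a word: each opening bracket is joined to its closing place. *)
Definition wmatch (n k : nat) (w : nat -> color) (i j : nat) : bool :=
  (w i == Op) && (close k w i == j %[mod n]) || (w j == Op) && (close k w j == i %[mod n]).

Section WordMatching.

Variables (n o k : nat) (w : nat -> color) (D : nat).
Hypothesis pw : periodic_word k w D.
Hypotheses (n_ok : n = (o * k)%N) (o_gt0 : (0 < o)%N) (D_o : D = 1%N -> o = 2%N).

Notation close := (close k w).
Notation M := (wmatch n k w).

Let w_per := pw_per pw.
Let k_gt0 := pw_gt0 pw.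

Let lekn : (k <= n)%N. Proof. by rewrite n_ok leq_pmull. Qed.

Let close_add i q : close (i + q * n) = (close i + q * n)%N.
Proof. by rewrite n_ok mulnA (close_perM pw). Qed.

Let w_add i q : w (i + q * n)%N = w i.
Proof. by rewrite n_ok mulnA (word_perM pw). Qed.

Lemma word_mod i i' : i = i' %[mod n] -> w i = w i'.
Proof.
wlog le : i i' / (i <= i')%N => [W|] E.
  by have [le|/ltnW le] := leqP i i'; [apply: W|apply/esym/W].
by have [q ->] := eqmod_addn E le; rewrite w_add.
Qed.

Lemma close_mod i i' : i = i' %[mod n] -> close i = close i' %[mod n].
Proof.
wlog le : i i' / (i <= i')%N => [W|] E.
  by have [le|/ltnW le] := leqP i i'; [apply: W|apply/esym/W].
by have [q ->] := eqmod_addn E le; rewrite close_add addnC modnMDl.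
Qed.

Lemma close_lt_n i : w i = Op -> (i < close i < i + n)%N.
Proof.
move=> wi; have /andP[lt le] := close_bounds pw i; rewrite lt /=.
have [E|ne] := eqVneq (close i) (i + k)%N; last by lia.
have o2 := D_o (close_unmatched pw wi E).
by rewrite E n_ok o2; lia.
Qed.

(** Only an unmatched bracket can be sent to an opening bracket. *)
Lemma close_op i : w i = Op -> w (close i) = Op ->
  close i = (i + k)%N /\ n = (2 * k)%N.
Proof.
move=> wi wc; have /andP[lt le] := close_bounds pw i.
have [ltc|] := ltnP (close i) (i + k).
  by have [_] := close_matched pw wi ltc; rewrite wc.
move=> gec; have E : close i = (i + k)%N by lia.
by split=> //; rewrite n_ok (D_o (close_unmatched pw wi E)).
Qed.

Lemma wmatchP i j : reflect
  (w i = Op /\ close i = j %[mod n] \/ w j = Op /\ close j = i %[mod n]) (M i j).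
Proof.
by apply: (iffP orP) => -[] H; [left|right|left|right]; move: H;
  [move/andP=> [/eqP ? /eqP ?]|move/andP=> [/eqP ? /eqP ?]|case=> -> ->|case=> -> ->]; rewrite ?eqxx.
Qed.

Lemma wmatch_close i : w i = Op -> M i (close i).
Proof. by move=> wi; apply/wmatchP; left. Qed.

(** Lifted to a window of length n starting at i, an edge is either the arc from
    i to j or the complementary arc from j to i + n. *)
Lemma wmatch_lift i j : (i < j < i + n)%N -> M i j ->
  w i = Op /\ close i = j \/ w j = Op /\ close j = (i + n)%N.
Proof.
move=> ltij /wmatchP[[wi E]|[wj E]]; [left|right]; split=> //.
  by apply: eqmod_window E (_ : (i <= _ < i + n)%N) _; have := close_lt_n wi; lia.
have {}E : close j = (i + n)%N %[mod n] by rewrite modnDr.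
by apply: eqmod_window E (_ : (j <= _ < j + n)%N) _; have := close_lt_n wj; lia.
Qed.

(** Uniqueness of partners comes from [close_inj], and noncrossing from
    [close_noncross] applied, after a shift by n if necessary, to the two arcs
    given by [wmatch_lift]. *)
Lemma wmatch_matching : matching n k M.
Proof.
have Msym i j : M i j = M j i by rewrite /wmatch orbC.
have Mmod i i' j : i = i' %[mod n] -> M i j = M i' j.
  by move=> E; rewrite /wmatch (word_mod E) (close_mod E) E.
split=> //.
- move=> i j; rewrite /wmatch !w_per !(close_per pw).
  by rewrite !eqn_modDr.
- have irr i j : w i = Op -> close i = j %[mod n] -> i <> j %[mod n].
    move=> wi E /esym E'; have := close_lt_n wi.
    suff : close i = i by lia.
    apply: (@eqmod_window _ _ i n); [by rewrite E | | ]; have := close_lt_n wi; lia.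
  move=> i j /wmatchP[[wi E]|[wj E]]; first exact: irr E.
  by move/esym; apply: irr E.
(* an opening bracket on which another one closes is the end of a diameter,
   and then both readings give the same partner *)
- have aux i j j' : w i = Op -> close i = j %[mod n] ->
      w j' = Op -> close j' = i %[mod n] -> j = j' %[mod n].
    move=> wi Ei wj Ej; have [E n2] := close_op wj (etrans (word_mod Ej) wi).
    rewrite -Ei -(close_mod Ej) E (close_per pw) E -addnA addnn -mul2n -n2.
    by rewrite modnDr.
  move=> i j j' /wmatchP[[wi Ei]|[wj Ej]] /wmatchP[[wi' Ei']|[wj' Ej']].
  + by rewrite -Ei -Ei'.
  + exact: aux Ei wj' Ej'.
  + by apply/esym; apply: aux Ei' wj Ej.
  have [wi|wi] := eqVneq (w i) Op.
    have [E n2] := close_op wj (etrans (word_mod Ej) wi).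
    have [E' _] := close_op wj' (etrans (word_mod Ej') wi).
    by apply/eqP; rewrite -(eqn_modDr k) -E -E' Ej Ej'.
  wlog le : j j' wj Ej wj' Ej' / (close j <= close j')%N => [W|].
    by have [le|/ltnW le] := leqP (close j) (close j'); [apply: W|apply/esym/W].
  have [q Eq] := eqmod_addn (etrans Ej (esym Ej')) le.
  have nc x : w x = Op -> close x = i %[mod n] -> (close x < x + k)%N.
    move=> wx Ex; have /andP[_ le'] := close_bounds pw x.
    rewrite ltn_neqAle le' andbT; apply: contra wi => /eqP E.
    by rewrite -(word_mod Ex) E w_per wx.
  rewrite -close_add in Eq.
  have E : (j + q * n)%N = j'.
    apply: (close_inj pw _ _ _ _ (esym Eq)) => //; rewrite ?w_add //; last exact: nc.
    by rewrite close_add; have := nc _ wj Ej; lia.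
  by rewrite -E addnC modnMDl.
- move=> i j s t ltis ltsj ltjt ltti Mij Mst.
  have nx := close_noncross pw.
  have wn x : w (x + n) = w x by have := w_add x 1; rewrite mul1n.
  have cn x : close (x + n) = (close x + n)%N by have := close_add x 1; rewrite mul1n.
  have [|[wi Ei]|[wj Ej]] := @wmatch_lift i j _ Mij; first by lia.
    have [|[ws Es]|[wt Et]] := @wmatch_lift s t _ Mst; first by lia.
      by apply: (nx i s) => //; rewrite ?Ei ?Es.
    by apply: (nx t (i + n)%N) => //; rewrite ?wn ?cn ?Ei ?Et //; lia.
  have [|[ws Es]|[wt Et]] := @wmatch_lift s t _ Mst; first by lia.
    by apply: (nx s j) => //; rewrite ?Ej ?Es; lia.
  by apply: (nx j t) => //; rewrite ?Ej ?Et; lia.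
Qed.

Lemma wmatch_cover i :
  (exists j, M i j) <-> (w i = Op \/ w i = Cl).
Proof.
split=> [[j /wmatchP[[-> _]|[wj E]]]|[wi|wi]]; [by left| | |].
- rewrite -(word_mod E); have /andP[_ le] := close_bounds pw j.
  have [lt|ge] := ltnP (close j) (j + k).
    by have [_ ->] := close_matched pw wj lt; right.
  by rewrite (_ : close j = (j + k)%N) ?w_per; [left|lia].
- by exists (close i); apply: wmatch_close.
have w2 : w (i + n)%N = Cl by have := w_add i 1; rewrite mul1n => ->.
have [|s' [ws' cs' _]] := close_onto pw w2; first by lia.
by exists s'; apply/wmatchP; right; rewrite cs' modnDr.
Qed.

End WordMatching.

(** * From a matching to a word *)

Section MatchingWord.

Variables (n o k : nat) (M : nat -> nat -> bool) (lp : nat -> bool).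
Hypotheses (n_ok : n = (o * k)%N) (o_gt0 : (0 < o)%N) (k_gt0 : (0 < k)%N).
Hypothesis mM : matching n k M.
Hypotheses (lp_per : forall i, lp (i + k)%N = lp i).
Hypothesis lpM : forall i j, M i j -> ~~ lp i.

Let lekn : (k <= n)%N. Proof. by rewrite n_ok leq_pmull. Qed.
Let n_gt0 : (0 < n)%N. Proof. exact: leq_trans lekn. Qed.
Let case_o : (o = 1%N /\ n = k) \/ ((1 < o)%N /\ (2 * k <= n)%N).
Proof.
have [le|lt] := leqP o 1; last by right; rewrite n_ok leq_pmul2r.
by left; rewrite n_ok (_ : o = 1%N) ?mul1n //; lia.
Qed.

(** For o > 1 a vertex opens when its partner is at most k steps ahead; for
    o = 1, where k = n and this always holds, the partner has to be reached
    without passing the cut between n - 1 and 0. *)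
Definition opens (i : nat) : bool :=
  has (fun t => M i (i + t.+1) && ((1 < o) || (i %% n + t.+1 < n))%N) (iota 0 k).

Definition covered (i : nat) : bool := has (fun t => M i (i + t.+1)) (iota 0 n).

Definition mword (i : nat) : color :=
  if opens i then Op else if covered i then Cl else if lp i then Lp else Bl.

Lemma opensP i : reflect
  (exists t, [/\ (0 < t <= k)%N, M i (i + t) & (1 < o)%N \/ (i %% n + t < n)%N]) (opens i).
Proof.
apply: (iffP hasP) => [[t]|[[|t] [] // /andP[_ le] m c]].
  rewrite mem_iota => lt /andP[m /orP c]; exists t.+1; split=> //; lia.
by exists t; rewrite ?mem_iota ?m //; apply/orP.
Qed.

Lemma matching_modr i j j' : j = j' %[mod n] -> M i j = M i j'.
Proof. by move=> E; rewrite (m_sym mM) (m_mod mM _ E) (m_sym mM). Qed.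

Lemma matching_forward i j : M i j -> exists t, [/\ (0 < t < n)%N, M i (i + t) & (i + t)%N = j %[mod n]].
Proof.
move=> m; pose t := ((j + (n - i %% n)) %% n)%N.
have E : (i + t)%N = j %[mod n].
  rewrite /t modnDmr addnCA -modnDmr -(modnDml i) subnKC ?modnn ?addn0 //.
  exact/ltnW/ltn_pmod.
exists t; split=> //; last by rewrite (matching_modr _ E).
rewrite ltn_pmod // andbT lt0n; apply/eqP=> t0.
by apply: (m_irr mM m); rewrite -E t0 addn0.
Qed.

Lemma coveredP i : reflect (exists j, M i j) (covered i).
Proof.
apply: (iffP hasP) => [[t _ m]|[j /matching_forward[[|t] [] // /andP[_ lt] m _]]].
  by exists (i + t.+1)%N.
by exists t; rewrite ?mem_iota //; lia.
Qed.

Lemma mword_op i : mword i = Op <-> opens i.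
Proof. by rewrite /mword; case: (opens i); case: (covered i); case: (lp i). Qed.

Lemma mword_cl i : mword i = Cl <-> covered i && ~~ opens i.
Proof. by rewrite /mword; case: (opens i); case: (covered i); case: (lp i). Qed.

Lemma mword_lp i : mword i = Lp <-> lp i.
Proof.
have : lp i -> ~~ covered i by move=> l; apply/coveredP=> -[j /lpM]; rewrite l.
have : lp i -> ~~ opens i by move=> l; apply/opensP=> -[t [_ /lpM]]; rewrite l.
rewrite /mword; case: (lp i) => [/(_ isT)/negPf-> /(_ isT)/negPf-> //|_ _].
by case: (opens i); case: (covered i).
Qed.

Lemma covered_mod i i' : i = i' %[mod n] -> covered i = covered i'.
Proof.
by move=> E; apply/coveredP/coveredP=> -[j m]; exists j; rewrite ?(m_mod mM _ E) // -(m_mod mM _ E).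
Qed.

Lemma opens_per i : opens (i + k) = opens i.
Proof.
apply: eq_has => t; rewrite addnAC (m_inv mM); congr (_ && _).
by case: case_o => [[_ nk]|[-> _] //]; rewrite {1 3}nk modnDr -nk.
Qed.

Lemma covered_per i : covered (i + k) = covered i.
Proof.
apply/coveredP/coveredP=> -[j m]; last by exists (j + k)%N; rewrite (m_inv mM).
exists (j + (n - k))%N; rewrite -(m_inv mM) -addnA subnK //.
by rewrite (@matching_modr _ _ j) // modnDr.
Qed.

Lemma mword_per i : mword (i + k) = mword i.
Proof. by rewrite /mword opens_per lp_per covered_per. Qed.

Lemma opens_mod i i' : i = i' %[mod n] -> opens i = opens i'.
Proof.
have P x q : opens (x + q * k) = opens x.
  by elim: q => [|q IH]; rewrite ?addn0 // mulSnr addnA opens_per.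
wlog le : i i' / (i <= i')%N => [W|] E.
  by have [le|/ltnW le] := leqP i i'; [apply: W|apply/esym/W].
by have [q ->] := eqmod_addn E le; rewrite n_ok mulnA P.
Qed.

(** If the partner at distance t < k also opened, at distance t', then t + t' would
    be n: for o > 1 this contradicts t + t' < 2 k <= n, for o = 1 it contradicts
    that neither distance passes the cut.  And if t = k, then s is joined to
    s + k and s + k to s + 2 k, hence 2 k = n. *)
Lemma opens_partner s : opens s ->
  exists t, [/\ (0 < t <= k)%N, M s (s + t), ((1 < o) || (s %% n + t < n))%N,
     (t < k)%N -> ~~ opens (s + t) & t = k -> o = 2%N].
Proof.
move/opensP=> [t [bt m c]]; exists t; split=> //; first exact/orP.
  move=> ltk; apply/opensP=> -[t' [bt' m' c']].
  rewrite (m_sym mM) in m; have E := m_uniq mM m m'; move/esym in E.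
  have [q Eq] : exists q, (t + t' = q * n)%N.
    have [|q Eq] := eqmod_addn (esym E); first by lia.
    by exists q; lia.
  case: q Eq => [|q] Eq; first by lia.
  case: case_o => [[o1 nk]|[o1 nk]]; last by rewrite mulSn in Eq; lia.
  have {}c : (s %% n + t < n)%N by lia.
  have {}c' : ((s + t) %% n + t' < n)%N by lia.
  have Em : ((s + t) %% n = s %% n + t)%N by rewrite -modnDml modn_small.
  by move: c'; rewrite Em -addnA Eq mulSn; lia.
move=> tk; rewrite tk in m c *.
have m2 : M (s + k) (s + k + k) by rewrite (m_inv mM).
rewrite (m_sym mM) in m; have E := m_uniq mM m m2.
have [|q Eq] := eqmod_addn E; first by lia.
have {}Eq : (2 * k = q * o * k)%N by rewrite -mulnA -n_ok; lia.
have {}Eq : (2 = q * o)%N by apply/eqP; rewrite -(eqn_pmul2r k_gt0); apply/eqP.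
case: case_o => [[o1 nk]|[o1 _]].
  by case: c => [|]; lia.
by case: q Eq => [|[|q]] //; rewrite ?mul1n // !mulSn; lia.
Qed.

(** If a vertex that is not opening had its partner at least k steps behind, the
    edge would cross its image under the rotation by k. *)
Lemma covered_partner s : covered s -> ~~ opens s -> (k <= s)%N ->
  exists u, [/\ (0 < u < k)%N, M (s - u) s & opens (s - u)] /\
    ((1 < o) || (u <= s %% n))%N.
Proof.
move=> /coveredP[j0 /matching_forward[t [bt m _]]] nop leks.
have ltu : (n - t < k)%N /\ ((1 < o) || (n - t <= s %% n))%N.
  case: case_o => [[o1 nk]|[o1 nk]].
    split; first by lia.
    rewrite leqNgt o1 /=; apply/negP=> lt; move/opensP: nop; apply.
    by exists t; split=> //; [lia|right; lia].
  split; last by rewrite o1.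
  have gtk : (k < t)%N.
    by rewrite ltnNge; apply/negP=> le; move/opensP: nop; apply; exists t; split; [lia| |left].
  have m2 : M (s + k) (s + t + k) by rewrite (m_inv mM).
  suff : (n < t + k)%N by lia.
  rewrite ltnNge; apply/negP=> le.
  have [E|ne] := eqVneq (t + k)%N n.
    have E2 : (s + t + k)%N = s %[mod n] by rewrite -addnA E modnDr.
    have E3 := matching_modr (s + k) E2; rewrite m2 (m_sym mM) in E3.
    have E4 := m_uniq mM m (esym E3).
    have : (s + t = s + k)%N by apply: eqmod_window E4 (_ : (s <= _ < s + n)%N) _; lia.
    by lia.
  by apply: (m_nc mM) m m2; lia.
exists (n - t)%N; have [lt1 lt2] := ltu.
have bu : (0 < n - t < k)%N by lia.
have m1 : M (s - (n - t)) s.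
  rewrite (m_sym mM) (@matching_modr _ _ (s + t)%N) //.
  by rewrite -[LHS]modnDr (_ : (s - (n - t) + n = s + t)%N) //; lia.
split=> //; split=> //; apply/opensP; exists (n - t)%N.
split; [by lia|by rewrite subnK //; lia|].
case: case_o lt2 => [[-> nk] /= lt2|[-> _] _]; [right|by left].
have sd := divn_eq s n.
have -> : (s - (n - t) = s %/ n * n + (s %% n - (n - t)))%N by lia.
rewrite modnMDl modn_small; have := ltn_pmod s n_gt0; lia.
Qed.

Definition arc i j := [&& opens i, (i < j < i + k)%N & M i j].

(** For o = 1 an arc lies in a single block of n consecutive lifts, before the cut. *)
Lemma arc_block i j : arc i j -> ((1 < o) || (i %% n + (j - i) < n))%N.
Proof.
case/and3P=> /opens_partner[t [bt m c _ _]] bj mj.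
have E := m_uniq mM m mj.
have : (i + t = j)%N by apply: eqmod_window E (_ : (i.+1 <= _ < i.+1 + n)%N) _; lia.
by move=> <-; rewrite addKn.
Qed.

Lemma arc_open i j s : arc i j -> (i < s < j)%N -> opens s -> exists2 t, (t < j)%N & arc s t.
Proof.
move=> a bs os; have blk := arc_block a; case/and3P: a => oi bj mij.
have [t [bt m c _ _]] := opens_partner os.
suff lt : (s + t < j)%N by exists (s + t)%N; rewrite // /arc os m andbT; lia.
rewrite ltnNge; apply/negP=> le.
have [E|ne] := eqVneq (s + t)%N j.
  rewrite E (m_sym mM) in m; rewrite (m_sym mM) in mij.
  have E2 := m_uniq mM m mij.
  suff : s = i by lia.
  by apply: eqmod_window E2 (_ : (i <= _ < i + n)%N) _; lia.
apply: (m_nc mM) mij m; try lia.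
case: case_o => [[o1 nk]|[o1 nk]]; last by lia.
have {}blk : (i %% n + (j - i) < n)%N by lia.
have {}c : (s %% n + t < n)%N by lia.
have Es : (s %% n = i %% n + (s - i))%N.
  rewrite -{1}(subnKC (_ : i <= s)%N); last by lia.
  by rewrite -modnDml modn_small //; lia.
by lia.
Qed.

Lemma arc_closes i j s : arc i j -> (i < s < j)%N -> (k <= s)%N ->
  covered s -> ~~ opens s -> exists2 t, (i < t)%N & arc t s.
Proof.
move=> a bs leks cs nos; have blk := arc_block a; case/and3P: a => oi bj mij.
have [u [[bu m os] c]] := covered_partner cs nos leks.
suff lt : (i < s - u)%N by exists (s - u)%N; rewrite // /arc os m andbT; lia.
rewrite ltnNge; apply/negP=> le.
have [E|ne] := eqVneq (s - u)%N i.
  rewrite E in m; have E2 := m_uniq mM m mij.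
  suff : s = j by lia.
  by apply: eqmod_window E2 (_ : (i <= _ < i + n)%N) _; lia.
apply: (m_nc mM) m mij; try lia.
case: case_o => [[o1 nk]|[o1 nk]]; last by lia.
have {}blk : (i %% n + (j - i) < n)%N by lia.
have {}c : (u <= s %% n)%N by lia.
have sd := divn_eq s n; have ls := ltn_pmod s n_gt0.
have Ei : (i = s %/ n * n + (s %% n - (s - i)))%N by lia.
have Em : (i %% n = s %% n - (s - i))%N.
  by rewrite {1}Ei modnMDl modn_small //; lia.
by lia.
Qed.

Section Closing.

Variable D : nat.
Hypotheses (pw : periodic_word k mword D) (D_o : D = 1%N -> o = 2%N).

(** By induction on the length of the arc.  If i closed at j0 < j, the arc ending
    at j0 would be inside (i, j), hence shorter, and by induction its start would
    also close at j0, against [close_inj].  If i closed after j, the bracket s closing at j would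
    start inside (i, j), by [close_noncross]; its arc is shorter and ends before
    j, again a contradiction. *)
Lemma arc_is_close i j : (k <= i)%N -> arc i j -> close k mword i = j.
Proof.
move: {2}(j - i).+1 (ltnSn (j - i)) => m; elim: m i j => // m IH i j ltm leki a.
have wi : mword i = Op by apply/mword_op; case/andP: a.
have bj : (i < j < i + k)%N by case/and3P: a.
have wj : covered j && ~~ opens j.
  case/and3P: (a) => oi _ mij; apply/andP; split.
    by apply/coveredP; exists i; rewrite (m_sym mM).
  have [t [bt m' c nop _]] := opens_partner oi.
  have E : (i + t = j)%N.
    by apply: eqmod_window (m_uniq mM m' mij) (_ : (i.+1 <= _ < i.+1 + n)%N) _; lia.
  by rewrite -E; apply: nop; lia.
have [ltc|gtc|//] := ltngtP (close k mword i) j.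
  set j0 := close k mword i in ltc *.
  have bc := close_bounds pw i; rewrite -/j0 in bc.
  have [|_ wj0] := close_matched pw wi; first by rewrite -/j0; lia.
  case/mword_cl/andP: wj0 => cj0 nj0.
  have [||s lts as_] := arc_closes a _ _ cj0 nj0; [by rewrite -/j0; lia|by rewrite -/j0; lia|].
  have bs : (s < j0 < s + k)%N by case/and3P: as_.
  have Es : close k mword s = j0 by apply: IH; rewrite // -/j0; lia.
  have ws : mword s = Op by apply/mword_op; case/andP: as_.
  have : i = s by apply: (close_inj pw); rewrite // ?Es // -/j0; lia.
  by lia.
have {}wj : mword j = Cl by apply/mword_cl.
have [|s [ws cs bs]] := close_onto pw wj; first by lia.
have [lt|lt|E] := ltngtP s i; last by move: gtc; rewrite -E cs ltnn.
  by case: (close_noncross pw ws wi lt); rewrite cs; lia.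
have os : opens s by apply/mword_op.
have [|t ltt ast] := arc_open a _ os; first by lia.
have bt : (s < t < s + k)%N by case/and3P: ast.
have : close k mword s = t by apply: IH => //; lia.
by rewrite cs; lia.
Qed.

(** The matching is recovered from its word.  Positions are shifted by n because
    [arc_is_close] looks back at most one period.  Once every edge of M is an
    edge of the matching of the word, uniqueness of partners in the latter gives
    the converse. *)
Lemma wmatch_mword i j : wmatch n k mword i j = M i j.
Proof.
have wM := wmatch_matching pw n_ok o_gt0 D_o.
have lift i' : (k <= i' + n)%N by lia.
have cn x : close k mword (x + n) = (close k mword x + n)%N.
  by rewrite n_ok (close_perM pw).
have half i' j' : opens i' -> M i' j' -> wmatch n k mword i' j'.
  move=> oi mij; apply/wmatchP; left; have wi : mword i' = Op by apply/mword_op.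
  split=> //; have [t [bt m c nop tk]] := opens_partner oi.
  have Ej := m_uniq mM m mij; rewrite -Ej.
  have on x : opens (x + n) = opens x by apply: opens_mod; rewrite modnDr.
  have mn x y : M (x + n) (y + n) = M x y.
    rewrite (m_mod mM _ (_ : _ = x %[mod n])) ?modnDr //.
    by apply: matching_modr; rewrite modnDr.
  have [ltk|gek] := ltnP t k.
    have : close k mword (i' + n) = (i' + t + n)%N.
      by apply: arc_is_close => //; rewrite /arc on oi mn m andbT; lia.
    by rewrite cn => /addIn ->.
  have {}gek : t = k by lia.
  clear nop tk c; have bc := close_bounds pw i'; have [ltc|] := ltnP (close k mword i') (i' + k); last first.
    by move=> ge; congr (_ %% _)%N; lia.
  have [_ /mword_cl/andP[cc noc]] := close_matched pw wi ltc.
  (* a diameter: if its end closed within a period, the arc ending there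
     would give it a second partner *)
  rewrite -(covered_mod (modnDr _ _)) -(covered_mod (modnDr _ _)) in cc.
  rewrite -on -on in noc.
  have [|u [[bu mu ou] _]] := covered_partner cc noc; first by lia.
  set J := (_ + n + n)%N in cc noc mu ou.
  have au : arc (J - u) J by rewrite /arc ou mu andbT; lia.
  have Eu : close k mword (J - u) = J by apply: arc_is_close => //; lia.
  have EJ : (J - u = i' + n + n)%N.
    apply: (close_inj pw); rewrite ?cn ?Eu //; try lia.
      exact/mword_op.
    by apply/mword_op; rewrite !on.
  rewrite EJ !mn in mu.
  by congr (_ %% _)%N; apply: eqmod_window (m_uniq mM mu m) (_ : (i'.+1 <= _ < i'.+1 + n)%N) _; lia.
have sub i' j' : M i' j' -> wmatch n k mword i' j'.
  move=> mij; have [oi|noi] := boolP (opens i'); first exact: half.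
  rewrite (m_sym wM); apply: half; last by rewrite (m_sym mM).
  have ci : covered (i' + n) by rewrite (covered_mod (modnDr _ _)); apply/coveredP; exists j'.
  rewrite -(opens_mod (modnDr i' n)) in noi.
  have [|u [[bu mu ou] _]] := covered_partner ci noi; first by lia.
  rewrite -(opens_mod (i := (i' + n - u)%N)) //.
  apply: (m_uniq mM (i := (i' + n)%N)); first by rewrite (m_sym mM).
  by rewrite (m_mod mM _ (modnDr _ _)).
apply/idP/idP=> [wij|]; last exact: sub.
have wit i' : mword i' = Op -> exists j'', M i' j''.
  by move=> /mword_op/opensP[t [_ m _]]; exists (i' + t)%N.
case/wmatchP: (wij) => -[wi _]; have [j' m] := wit _ wi.
  by rewrite -(matching_modr _ (m_uniq wM (sub _ _ m) wij)).
rewrite (m_sym wM) in wij; rewrite (m_sym mM).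
by rewrite -(matching_modr _ (m_uniq wM (sub _ _ m) wij)).
Qed.

End Closing.

End MatchingWord.

(** The word is recovered from its matching.  For o > 1 the orientation is
    forced since the complementary arc of a matched pair is longer than k; for
    o = 1 it is the hypothesis that the path stays nonnegative which makes
    every bracket close before the cut. *)
Lemma mword_wmatch n o k w D i : periodic_word k w D -> n = (o * k)%N -> (0 < o)%N ->
  (D = 1%N -> o = 2%N) -> (o = 1%N -> forall t, (t <= k)%N -> 0 <= height w t) ->
  mword n o k (wmatch n k w) (fun j => w j == Lp) i = w i.
Proof.
move=> pw nok o0 Do bal; have k0 := pw_gt0 pw.
have lekn : (k <= n)%N by rewrite nok leq_pmull.
have n0 : (0 < n)%N by exact: leq_trans lekn.
have case_o : (o = 1%N /\ n = k) \/ ((1 < o)%N /\ (2 * k <= n)%N).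
  have [le|lt] := leqP o 1; last by right; rewrite nok leq_pmul2r.
  by left; rewrite nok (_ : o = 1%N) ?mul1n //; lia.
have mM := wmatch_matching pw nok o0 Do.
have wb x : o = 1%N -> w x = Op -> (x < n)%N -> (close k w x < n)%N.
  move=> o1 wx; have nk : n = k by rewrite nok o1 mul1n.
  rewrite nk; apply: (ballot_close pw) (bal o1) wx.
  by have := pw_drift_le1 pw; case: D Do {pw mM} => // -[|//] /(_ erefl); rewrite o1.
have split_close x : close k w x = (close k w (x %% n) + x %/ n * n)%N.
  have := close_perM pw (x %% n) (x %/ n * o); rewrite -mulnA -nok.
  by rewrite [(x %% n + _)%N]addnC -divn_eq.
have wmodn x : w (x %% n)%N = w x.
  by apply: (word_mod pw nok); rewrite modn_mod.
have cov := wmatch_cover pw nok o0 Do i.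
have opE : opens n o k (wmatch n k w) i = (w i == Op).
  apply/opensP/eqP=> [[t [bt m c]]|wi].
    have ltn : (t < n)%N.
      rewrite ltn_neqAle (leq_trans _ lekn) ?andbT; last by lia.
      by apply/eqP=> tn; apply: (m_irr mM m); rewrite tn modnDr.
    have [|[//]|[wt Et]] := wmatch_lift pw nok o0 Do _ m; first by lia.
    case: case_o => [[o1 nk]|[o1 nk]].
      have {}c : (i %% n + t < n)%N by lia.
      have E : ((i + t) %% n = i %% n + t)%N by rewrite -modnDml modn_small.
      have := wb _ o1 _ c; rewrite -E wmodn => /(_ wt).
      have := split_close (i + t)%N; rewrite Et.
      have := divn_eq (i + t) n; have := divn_eq i n; rewrite E.
      suff -> : ((i + t) %/ n = i %/ n)%N by lia.
      by rewrite {1}(divn_eq i n) -addnA (divnMDl _ _ n0) (divn_small c) addn0.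
    have bc := close_bounds pw (i + t).
    have [lt|ge] := ltnP (close k w (i + t)) (i + t + k); first by lia.
    have E : (i + t + k = i + n)%N by lia.
    have : w (i + n)%N = Op by rewrite -E (pw_per pw).
    by rewrite -wmodn modnDr wmodn.
  have bc := close_bounds pw i; exists (close k w i - i)%N.
  rewrite subnKC; last by lia.
  split; [by lia|exact: wmatch_close|].
  case: case_o => [[o1 nk]|[o1 _]]; [right|by left].
  have := wb (i %% n)%N o1; rewrite wmodn ltn_pmod // => /(_ wi isT).
  by have := split_close i; have := divn_eq i n; lia.
rewrite /mword opE; case: eqP => [->//|nop].
case: (coveredP nok o0 k0 mM i) => [/cov[//|->//]|nc].
by case: eqP => [->//|nl]; move: nop nl nc cov; case: (w i) => [[[]|]|] //= _ _ nc [_ H]; case: nc; apply: H; right.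
Qed.

(** * Sets of chords *)

Section Circle.

Variables (n : nat) (n_gt0 : (0 < n)%N).

Definition vtx (i : nat) : 'I_n := Ordinal (ltn_pmod i n_gt0).

Lemma vtx_val (v : 'I_n) : vtx v = v.
Proof. by apply: val_inj; rewrite /= modn_small. Qed.

Lemma vtxP i j : reflect (i = j %[mod n]) (vtx i == vtx j).
Proof. by apply: (iffP eqP) => [/(congr1 val)//|E]; apply: val_inj. Qed.

Definition chord (i j : nat) : {set 'I_n} := [set vtx i; vtx j].

Lemma chordC i j : chord i j = chord j i.
Proof. by rewrite /chord setUC. Qed.

Lemma card_chord i j : (#|chord i j| == 2) = ~~ (i == j %[mod n]).
Proof.
rewrite cards2; case: vtxP => [/eqP->//|/eqP/negPf->//].
Qed.

Lemma crossing_intro (A B : {set 'I_n}) (a b c d : nat) :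
  vtx a \in A -> vtx b \in A -> vtx c \in B -> vtx d \in B ->
  (a %% n < c %% n)%N -> (c %% n < b %% n)%N -> (b %% n < d %% n)%N -> crossing A B.
Proof.
move=> aA bA cB dB ac cb bd; apply/existsP; exists (vtx a); rewrite aA /=.
apply/existsP; exists (vtx b); rewrite bA /=.
apply/existsP; exists (vtx c); rewrite cB /=.
by apply/existsP; exists (vtx d); rewrite dB /= ac cb bd.
Qed.

Lemma modn_window i y : (y < n)%N ->
  ((i + y) %% n = if i %% n + y < n then i %% n + y else i %% n + y - n)%N.
Proof.
move=> ltyn; have lt := ltn_pmod i n_gt0.
rewrite -modnDml; case: ltnP => [l|g]; first by rewrite modn_small.
by rewrite -{1}(subnK g) modnDr modn_small //; lia.
Qed.

(** Crossing is defined from the numbering 0, ..., n - 1; the four cases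
    correspond to the place of the cut among the four points, and the cut
    exchanges the roles of the two chords. *)
Lemma chord_crossing i s j t : (i < s)%N -> (s < j)%N -> (j < t)%N -> (t < i + n)%N ->
  crossing (chord i j) (chord s t) || crossing (chord s t) (chord i j).
Proof.
move=> ltis ltsj ltjt ltti.
have [Es Ej Et] : [/\ s = i + (s - i), j = i + (j - i) & t = i + (t - i)]%N by split; lia.
have ms := @modn_window i (s - i) ltac:(lia); rewrite -Es in ms.
have mj := @modn_window i (j - i) ltac:(lia); rewrite -Ej in mj.
have mt := @modn_window i (t - i) ltac:(lia); rewrite -Et in mt.
have lt := ltn_pmod i n_gt0.
have in1 x y : vtx x \in chord x y by rewrite !inE eqxx.
have in2 x y : vtx y \in chord x y by rewrite !inE eqxx orbT.
move: ms mj mt; case: ltnP => c1 ms; case: ltnP => c2 mj; case: ltnP => c3 mt; try lia.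
- apply/orP; left; apply: (crossing_intro (in1 i j) (in2 i j) (in1 s t) (in2 s t)); lia.
- apply/orP; right; apply: (crossing_intro (in2 s t) (in1 s t) (in1 i j) (in2 i j)); lia.
- apply/orP; left; apply: (crossing_intro (in2 i j) (in1 i j) (in2 s t) (in1 s t)); lia.
- apply/orP; right; apply: (crossing_intro (in1 s t) (in2 s t) (in2 i j) (in1 i j)); lia.
Qed.

Lemma card2_chord (A : {set 'I_n}) : #|A| == 2 -> exists i j, A = chord i j.
Proof.
by case/cards2P=> a [b [_ ->]]; exists a, b; rewrite /chord !vtx_val.
Qed.

Lemma card2_chord_at (A : {set 'I_n}) (v : nat) : #|A| == 2 -> vtx v \in A ->
  exists j, A = chord v j.
Proof.
move=> /card2_chord[i [j ->]]; rewrite !inE => /orP[/eqP E|/eqP E].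
  by exists j; rewrite /chord E.
by exists i; rewrite chordC /chord E.
Qed.

Definition joined (E : {set {set 'I_n}}) (i j : nat) : bool := chord i j \in E.

Definition planar (E : {set {set 'I_n}}) : bool :=
  [&& [forall A in E, #|A| == 2], trivIset E
    & [forall A in E, forall B in E, ~~ crossing A B]].

Lemma planarP (E : {set {set 'I_n}}) : reflect
  [/\ forall A, A \in E -> #|A| == 2,
      forall A B v, A \in E -> B \in E -> v \in A -> v \in B -> A = B
    & forall A B, A \in E -> B \in E -> ~~ crossing A B] (planar E).
Proof.
apply: (iffP and3P) => [[/forall_inP H1 /trivIsetP H2 /forall_inP H3]|[H1 H2 H3]]; split=> //.
- move=> A B v AE BE vA vB; apply/eqP; apply: contraT => ne.
  by have /pred0P/(_ v) := H2 _ _ AE BE ne; rewrite /= vA vB.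
- by move=> A B AE BE; have /forall_inP := H3 A AE; apply.
- exact/forall_inP.
- apply/trivIsetP=> A B AE BE ne; apply/pred0P=> v /=; apply/negP=> /andP[vA vB].
  by move/eqP: ne; apply; apply: H2 vA vB.
- by apply/forall_inP=> A AE; apply/forall_inP=> B BE; apply: H3.
Qed.

Lemma joined_mod E i i' j : i = i' %[mod n] -> joined E i j = joined E i' j.
Proof. by move=> /vtxP/eqP E1; rewrite /joined /chord E1. Qed.

Lemma joined_matching E k : planar E ->
  (forall i j, joined E (i + k) (j + k) = joined E i j) -> matching n k (joined E).
Proof.
case/planarP=> H2 Ht Hc inv; have irr i j : joined E i j -> i <> j %[mod n].
  by move=> /H2; rewrite card_chord => /eqP.
split=> //.
- by move=> i j; rewrite /joined chordC.
- by move=> i i' j; apply: joined_mod.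
- move=> i j j' m m'; have := irr _ _ m; move/vtxP/negPf => nij.
  have E1 : chord i j = chord i j' by apply: (Ht _ _ (vtx i)); rewrite // !inE eqxx.
  have : vtx j \in chord i j' by rewrite -E1 !inE eqxx orbT.
  by rewrite !inE eq_sym nij => /vtxP.
- move=> i j s t l1 l2 l3 l4 m m'; have := chord_crossing l1 l2 l3 l4.
  by rewrite (negPf (Hc _ _ m m')) (negPf (Hc _ _ m' m)).
Qed.

Definition chords_of (M : nat -> nat -> bool) : {set {set 'I_n}} :=
  [set A | [exists a : 'I_n, exists b : 'I_n, (A == chord a b) && M a b]].

Section ChordsOf.

Variables (k : nat) (M : nat -> nat -> bool).
Hypothesis mM : matching n k M.

Let M_mod2 i j i' j' : i = i' %[mod n] -> j = j' %[mod n] -> M i j = M i' j'.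
Proof. by move=> Ei Ej; rewrite (m_mod mM _ Ei) (m_sym mM) (m_mod mM _ Ej) (m_sym mM). Qed.

Lemma joined_chords_of i j : joined (chords_of M) i j = M i j.
Proof.
rewrite /joined inE; apply/existsP/idP=> [[a /existsP[b /andP[/eqP E m]]]|m].
  have ab : ~~ (vtx a == vtx b) by apply/vtxP; exact: (m_irr mM m).
  have : vtx a \in chord i j by rewrite E !inE eqxx.
  have : vtx b \in chord i j by rewrite E !inE eqxx orbT.
  rewrite !inE => /orP[/eqP Eb|/eqP Eb] /orP[/eqP Ea|/eqP Ea].
  - by rewrite Ea Eb eqxx in ab.
  - by rewrite (m_sym mM) -(M_mod2 (_ : (a = j %[mod n])%N) (_ : (b = i %[mod n])%N)) //; apply/vtxP/eqP.
  - by rewrite -(M_mod2 (_ : (a = i %[mod n])%N) (_ : (b = j %[mod n])%N)) //; apply/vtxP/eqP.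
  - by rewrite Ea Eb eqxx in ab.
exists (vtx i); apply/existsP; exists (vtx j).
by rewrite /chord !vtx_val eqxx (M_mod2 (_ : _ = i %[mod n]) (_ : _ = j %[mod n])) //= ?modn_mod.
Qed.

Lemma chords_ofP A : reflect (exists i j, A = chord i j /\ M i j) (A \in chords_of M).
Proof.
apply: (iffP idP) => [|[i [j [-> m]]]]; last by have := joined_chords_of i j; rewrite m.
by rewrite inE => /existsP[a /existsP[b /andP[/eqP -> m]]]; exists a, b.
Qed.

Lemma planar_chords_of : planar (chords_of M).
Proof.
apply/planarP; split.
- move=> _ /chords_ofP[i [j [-> m]]]; rewrite card_chord; apply/eqP.
  exact: (m_irr mM m).
- have at_v A v : A \in chords_of M -> v \in A -> exists2 j : nat, A = chord v j & M v j.
    case/chords_ofP=> i [j [-> m]]; rewrite !inE => /orP[/eqP->|/eqP->].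
      exists j; last by rewrite (M_mod2 (_ : _ = i %[mod n]) (_ : _ = j %[mod n])) //= modn_mod.
      by rewrite /chord vtx_val.
    exists i; first by rewrite chordC /chord vtx_val.
    by rewrite (m_sym mM) (M_mod2 (_ : _ = i %[mod n]) (_ : _ = j %[mod n])) //= modn_mod.
  move=> A B v /at_v HA /at_v HB /HA[j -> m] /HB[j' -> m'].
  by rewrite /chord; have /vtxP/eqP -> := m_uniq mM m m'.
move=> A B AE BE; apply/negP.
case/existsP=> a /andP[aA /existsP[b /andP[bA /existsP[c /andP[cB /existsP[d]]]]]].
case/and4P=> dB ac cb bd.
have mk X (x y : 'I_n) : X \in chords_of M -> x \in X -> y \in X -> (x < y)%N -> M x y.
  move=> XE xX yX ltxy; have := joined_chords_of x y; rewrite /joined /chord !vtx_val => <-.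
  case/chords_ofP: (XE) => i [j [EX m]]; rewrite (_ : [set x; y] = X) //.
  move: xX yX; rewrite EX !inE => /orP[/eqP Ex|/eqP Ex] /orP[/eqP Ey|/eqP Ey].
  - by rewrite Ex Ey ltnn in ltxy.
  - by rewrite Ex Ey.
  - by rewrite Ex Ey chordC.
  - by rewrite Ex Ey ltnn in ltxy.
apply: (m_nc mM ac cb bd).
- by rewrite (leq_trans (ltn_ord d)) // leq_addl.
- by apply: mk AE aA bA _; lia.
- by apply: mk BE cB dB _; lia.
Qed.

End ChordsOf.

Lemma chords_of_joined E : planar E -> chords_of (joined E) = E.
Proof.
case/planarP=> H2 _ _; apply/setP=> A; rewrite inE; apply/existsP/idP=> [[a /existsP[b]]|AE].
  by case/andP=> /eqP->.
have /card2_chord[i [j EA]] := H2 A AE.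
exists (vtx i); apply/existsP; exists (vtx j).
have Ec : chord (vtx i) (vtx j) = A by rewrite EA /chord !vtx_val.
by rewrite /joined Ec eqxx.
Qed.

Lemma eq_chords_of M M' : (forall i j, M i j = M' i j) -> chords_of M = chords_of M'.
Proof.
by move=> E; apply/setP=> A; rewrite !inE; apply: eq_existsb => a; apply: eq_existsb => b; rewrite E.
Qed.

Lemma rot_permX m i : (rot_perm n ^+ m)%g (vtx i) = vtx (i + m).
Proof.
elim: m => [|m IH]; first by rewrite expg0 perm1 addn0.
rewrite expgSr permM IH permE; apply: val_inj => /=.
by rewrite -addn1 modnDml addn1 addnS.
Qed.

Lemma rot_chord m i j : (rot_perm n ^+ m)%g @: chord i j = chord (i + m) (j + m).
Proof. by rewrite /chord imsetU1 imset_set1 !rot_permX. Qed.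

End Circle.

(** * Words of invariant sets of chords *)

Lemma sum_periodic (V : nmodType) (F : nat -> V) o k : (forall i, F (k + i)%N = F i) ->
  \sum_(i < o * k) F i = (\sum_(i < k) F i) *+ o.
Proof.
move=> per; elim: o => [|o IH]; first by rewrite mul0n big_ord0 mulr0n.
rewrite mulSn big_split_ord mulrS -IH; congr (_ + _).
by apply: eq_bigr => i _; rewrite /= per.
Qed.

(** The k-periodic word with period t. *)
Definition cyc k (t : k.-tuple color) (i : nat) : color := nth Bl t (i %% k)%N.

Lemma cyc_per k (t : k.-tuple color) i : cyc t (i + k) = cyc t i.
Proof. by rewrite /cyc modnDr. Qed.

Lemma cyc_tnth k (t : k.-tuple color) (i : 'I_k) : cyc t i = tnth t i.
Proof. by rewrite /cyc modn_small // (tnth_nth Bl). Qed.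

Lemma height_cyc k (t : k.-tuple color) :
  height (cyc t) k = (count_mem Op t)%:Z - (count_mem Cl t)%:Z.
Proof.
rewrite /height (eq_bigr (fun i => step (tnth t i))); last by move=> i _; rewrite cyc_tnth.
rewrite -(big_tuple _ _ t xpredT step) /=.
elim: (t : seq _) => [|c s IH]; first by rewrite big_nil.
by rewrite big_cons IH /=; case: c => [[[]|]|] /=; lia.
Qed.

Lemma card_cyc n o k (t : k.-tuple color) (P : pred color) : n = (o * k)%N ->
  #|[set v : 'I_n | P (cyc t v)]| = (o * count P t)%N.
Proof.
move=> ->; rewrite -sum1dep_card big_mkcond /=.
transitivity ((\sum_(i < k) (P (cyc t i) : nat)) *+ o).
  rewrite -(@sum_periodic nat (fun i => P (cyc t i) : nat)) => [|i]; last by rewrite addnC cyc_per.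
  by apply: eq_bigr => i _; case: (P _).
rewrite -mulr_natl natn; congr (_ * _)%N.
rewrite -sum1_count big_tuple [RHS]big_mkcond.
by apply: eq_bigr => i _; rewrite cyc_tnth; case: (P _).
Qed.

(** Exactly one end of an edge opens, unless the edge is an invariant diameter. *)
Lemma opens_pair n o k M : n = (o * k)%N -> (0 < o)%N -> (0 < k)%N -> matching n k M ->
  forall i j, M i j -> ((1 < o)%N -> (i + k)%N <> j %[mod n]) -> 
  opens n o k M j = ~~ opens n o k M i.
Proof.
move=> nok o0 k0 mM i j m ndiam.
have lekn : (k <= n)%N by rewrite nok leq_pmull.
have [oi|noi] := boolP (opens n o k M i) => /=.
  have [t [bt mt c nop tk]] := opens_partner nok o0 k0 mM oi.
  have E := m_uniq mM mt m; have [ltk|gek] := ltnP t k.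
    by apply/negbTE; rewrite -(opens_mod nok o0 k0 mM E) nop.
  have {}gek : t = k by lia.
  by case: (ndiam _); [rewrite tk|rewrite -E gek].
have ci : covered n M (i + n).
  rewrite (covered_mod nok o0 k0 mM (modnDr _ _)).
  by apply/(coveredP nok o0 k0 mM); exists j.
rewrite -(opens_mod nok o0 k0 mM (modnDr i n)) in noi.
have [|u [[bu mu ou] _]] := covered_partner nok o0 k0 mM ci noi; first by lia.
rewrite -(opens_mod nok o0 k0 mM (i := (i + n - u)%N)) //.
apply: (m_uniq mM (i := (i + n)%N)); first by rewrite (m_sym mM).
by rewrite (m_mod mM _ (modnDr _ _)).
Qed.

Section FixedConfigurations.

Variables (n o k : nat).
Hypotheses (n_ok : n = (o * k)%N) (o_gt0 : (0 < o)%N) (k_gt0 : (0 < k)%N) (n_gt0 : (0 < n)%N).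

Notation vtx := (vtx n_gt0).
Notation chord := (chord n_gt0).
Notation joined := (joined n_gt0).
Notation r := (rot_perm n ^+ k)%g.

Let lekn : (k <= n)%N. Proof. by rewrite n_ok leq_pmull. Qed.
Let n2k : (1 < o)%N -> (2 * k <= n)%N. Proof. by move=> lt; rewrite n_ok leq_pmul2r. Qed.
Let nk1 : o = 1%N -> n = k. Proof. by move=> o1; rewrite n_ok o1 mul1n. Qed.

Definition fixed_edges (E : {set {set 'I_n}}) := [set A in E | r @: A == A].

Section Edges.

Variable E : {set {set 'I_n}}.
Hypotheses (plE : planar E) (rE : [set r @: A | A : {set 'I_n} in E] = E).

Lemma rot_joined i j : joined E (i + k) (j + k) = joined E i j.
Proof.
rewrite /joined -rot_chord -{1}rE mem_imset //; apply: imset_inj; exact: perm_inj.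
Qed.

Let mM : matching n k (joined E) := joined_matching plE rot_joined.

Notation opens := (opens n o k (joined E)).
Notation covered := (covered n (joined E)).

Lemma cover_covered v : (vtx v \in cover E) = covered v.
Proof.
have [H2 _ _] := planarP _ plE.
apply/bigcupP/(coveredP n_ok o_gt0 k_gt0 mM) => [[A AE vA]|[j m]].
  by have [j EA] := card2_chord_at (H2 _ AE) vA; exists j; rewrite /joined -EA.
by exists (chord v j); rewrite // !inE eqxx.
Qed.

Lemma fixed_chord i j : (1 < o)%N -> joined E i j ->
  (r @: chord i j == chord i j) = ((i + k)%N == j %[mod n]).
Proof.
move=> o1 m; have [_ Ht _] := planarP _ plE.
have mr : joined E (i + k) (j + k) by rewrite rot_joined.
rewrite rot_chord; apply/eqP/eqP=> [Ec|/vtxP/eqP Ev].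
  have : vtx (i + k) \in chord i j by rewrite -Ec !inE eqxx.
  rewrite !inE => /orP[/vtxP Ev|/vtxP //].
  have := n2k o1; suff : (i + k = i)%N by lia.
  by apply: eqmod_window Ev (_ : (i <= _ < i + n)%N) _; have := n2k o1; lia.
by apply: (Ht _ _ (vtx j)) => //; rewrite !inE -?Ev eqxx ?orbT.
Qed.

(** The step of the path at i depends on the edges alone, so that the sums over
    edges below need not mention the loops. *)
Definition bracket_step i : int := if opens i then 1 else if covered i then -1 else 0.

Lemma step_mword lp i : step (mword n o k (joined E) lp i) = bracket_step i.
Proof. by rewrite /mword /bracket_step; case: opens; case: covered; case: (lp i). Qed.

Lemma bracket_step_mod i : bracket_step (i %% n)%N = bracket_step i.
Proof.
have Em : (i %% n)%N = i %[mod n] by rewrite modn_mod.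
by rewrite /bracket_step (opens_mod n_ok o_gt0 k_gt0 mM Em) (covered_mod n_ok o_gt0 k_gt0 mM Em).
Qed.

Lemma sum_cover_steps (P : pred 'I_n) :
  \sum_(v : 'I_n | P v) bracket_step v =
  \sum_(A in E) \sum_(v in A | P v) bracket_step v.
Proof.
have tE : trivIset E by case/and3P: plE.
transitivity (\sum_(v in cover E | P v) bracket_step v); last exact: big_trivIset_cond.
rewrite [LHS]big_mkcond [RHS]big_mkcond; apply: eq_bigr => v _.
have := cover_covered v; rewrite vtx_val => ->.
rewrite /bracket_step; case: (coveredP n_ok o_gt0 k_gt0 mM v) => //= nc; case: (P v) => //.
by case: opensP => // -[t [_ m _]]; case: nc; exists (v + t)%N.
Qed.

Lemma sum_chord i j (P : pred 'I_n) : joined E i j ->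
  \sum_(v in chord i j | P v) bracket_step v =
  (if P (vtx i) then bracket_step i else 0) + (if P (vtx j) then bracket_step j else 0).
Proof.
move=> m; have ne : vtx i \notin [set vtx j].
  by rewrite inE; apply/vtxP; exact: (m_irr mM m).
rewrite big_mkcondr /= /chord big_setU1 //= big_set1 !bracket_step_mod //.
Qed.

Lemma joined_step i j : joined E i j -> ((1 < o)%N -> (i + k)%N <> j %[mod n]) ->
  bracket_step i + bracket_step j = 0.
Proof.
move=> m nd; rewrite /bracket_step (opens_pair n_ok o_gt0 k_gt0 mM m nd).
have ci : covered i by apply/(coveredP n_ok o_gt0 k_gt0 mM); exists j.
have cj : covered j by apply/(coveredP n_ok o_gt0 k_gt0 mM); exists i; rewrite (m_sym mM).
by rewrite ci cj; case: opens.
Qed.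

Lemma sum_steps_order1 : o = 1%N -> \sum_(v : 'I_n) bracket_step v = 0.
Proof.
move=> o1; rewrite (sum_cover_steps xpredT) big1 // => A AE.
have [H2 _ _] := planarP _ plE; have [i [j EA]] := card2_chord n_gt0 (H2 _ AE).
rewrite EA in AE *; rewrite sum_chord //; apply: joined_step => //; lia.
Qed.

(** This computes the drift of the word: steps cancel along an edge, except on an
    invariant diameter, both ends of which go up. *)
Lemma sum_steps : (1 < o)%N -> \sum_(v : 'I_n) bracket_step v = (2 * #|fixed_edges E|)%N.
Proof.
move=> o1; rewrite (sum_cover_steps xpredT).
rewrite (bigID (fun A : {set 'I_n} => r @: A == A)) /= addrC big1 ?add0r; last first.
  move=> A /andP[AE]; have [H2 _ _] := planarP _ plE; have [i [j EA]] := card2_chord n_gt0 (H2 _ AE).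
  rewrite EA in AE *; rewrite fixed_chord // => /eqP nd.
  by rewrite sum_chord //; apply: joined_step.
rewrite (eq_bigr (fun=> 2)).
  rewrite sumr_const (_ : #|_| = #|fixed_edges E|); first by rewrite -[LHS]mulr_natr !natz PoszM.
  by apply: eq_card => A; rewrite !inE.
move=> A /andP[AE]; have [H2 _ _] := planarP _ plE; have [i [j EA]] := card2_chord n_gt0 (H2 _ AE).
rewrite EA in AE *; rewrite fixed_chord // => /eqP dd.
rewrite sum_chord //=; have oi : opens i.
  apply/opensP; exists k; rewrite leqnn k_gt0; split=> //; last by left.
  by rewrite (matching_modr mM _ dd).
have oj : opens j by rewrite -(opens_mod n_ok o_gt0 k_gt0 mM dd) opens_per.
by rewrite /bracket_step oi oj.
Qed.

Lemma fixed_edges_o2 A : (1 < o)%N -> A \in fixed_edges E -> o = 2%N.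
Proof.
move=> o1; rewrite inE => /andP[AE]; have [H2 _ _] := planarP _ plE.
have [i [j EA]] := card2_chord n_gt0 (H2 _ AE).
rewrite EA in AE *; rewrite fixed_chord // => /eqP dd.
have oi : opens i.
  apply/opensP; exists k; rewrite leqnn k_gt0; split=> //; last by left.
  by rewrite (matching_modr mM _ dd).
have [t [bt mt _ _]] := opens_partner n_ok o_gt0 k_gt0 mM oi; apply.
rewrite -/(joined E i j) -(matching_modr mM _ dd) in AE.
have := m_uniq mM mt AE => Et; have := n2k o1.
suff : (i + t = i + k)%N by lia.
by apply: eqmod_window Et (_ : (i <= _ < i + n)%N) _; have := n2k o1; lia.
Qed.

(** Two invariant diameters would cross. *)
Lemma fixed_edges_le1 : (1 < o)%N -> (#|fixed_edges E| <= 1)%N.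
Proof.
move=> o1.
have repr A : A \in fixed_edges E -> exists2 x, (x < k)%N & A = chord x (x + k) /\ joined E x (x + k).
  rewrite inE => /andP[AE fA]; have [H2 _ _] := planarP _ plE.
  have [i [j EA]] := card2_chord n_gt0 (H2 _ AE).
  have mij : joined E i j by rewrite /joined -EA.
  have : r @: chord i j == chord i j by rewrite -EA.
  rewrite fixed_chord // => /eqP/vtxP/eqP Ev.
  have {Ev}EA : A = chord i (i + k) by rewrite EA /chord Ev.
  rewrite {1 2}(divn_eq i k) in EA; exists (i %% k)%N; first exact: ltn_pmod.
  suff H q : A = chord (i %% k + q * k) (i %% k + q * k + k) -> A = chord (i %% k) (i %% k + k).
    have {}EA : A = chord (i %% k) (i %% k + k) by apply: (H (i %/ k)%N); rewrite addnC.
    by rewrite /joined -EA.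
  elim: q => [|q IH]; first by rewrite addn0.
  rewrite mulSnr !addnA -rot_chord => EA'; apply: IH.
  have rinj : injective (fun A : {set 'I_n} => r @: A) by apply: imset_inj; exact: perm_inj.
  by apply: rinj; rewrite -EA'; apply/eqP.
apply/card_le1_eqP=> A B /repr[x ltx [-> mx]] /repr[y lty [-> my]].
have n2 := n2k o1; have [lt|lt|->//] := ltngtP x y.
  by case: (m_nc mM (i := x) (j := (x + k)%N) (s := y) (t := (y + k)%N)); rewrite //; lia.
by case: (m_nc mM (i := y) (j := (y + k)%N) (s := x) (t := (x + k)%N)); rewrite //; lia.
Qed.

Lemma height_bracket lp t : (t <= n)%N ->
  height (mword n o k (joined E) lp) t = \sum_(v : 'I_n | (v < t)%N) bracket_step v.
Proof.
move=> le; rewrite /height (big_ord_widen n (fun i => step (mword n o k (joined E) lp i))) //.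
by apply: eq_bigr => v _; rewrite step_mword.
Qed.

(** For o = 1 each edge contributes 1 or 0 to the height at t, according to
    whether t separates its ends. *)
Lemma height_ballot lp t : o = 1%N -> (t <= k)%N -> 0 <= height (mword n o k (joined E) lp) t.
Proof.
move=> o1; have nk := nk1 o1 => le; have len : (t <= n)%N by rewrite nk.
rewrite height_bracket // sum_cover_steps.
apply: sumr_ge0 => A AE; have [H2 _ _] := planarP _ plE.
have pos (i j : nat) : A = chord i j -> (i < j < n)%N ->
    0 <= \sum_(v in A | (v < t)%N) bracket_step v.
  move=> EA ltij; have m : joined E i j by rewrite /joined -EA.
  have oi : opens i.
    apply/opensP; exists (j - i)%N; rewrite subnKC; last by lia.
    split=> //; [lia|right; rewrite modn_small; lia].
  have := joined_step m ltac:(lia); rewrite EA sum_chord //= !modn_small; [|lia|lia].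
  have : bracket_step i = 1 by rewrite /bracket_step oi.
  by case: ltnP => c1; case: ltnP => c2; lia.
have [x [y EA]] := card2_chord n_gt0 (H2 _ AE).
have {}EA : A = chord (x %% n) (y %% n).
  by rewrite EA /chord; congr [set _ ; _]; apply/eqP/vtxP; rewrite modn_mod.
have lx := ltn_pmod x n_gt0; have ly := ltn_pmod y n_gt0.
have ne : (x %% n)%N <> (y %% n)%N.
  by have := m_irr mM (i := (x %% n)%N) (j := (y %% n)%N); rewrite /joined -EA !modn_mod => /(_ AE).
have [lt|lt|//] := ltngtP (x %% n) (y %% n); first by apply: pos EA _; lia.
by rewrite chordC in EA; apply: pos EA _; lia.
Qed.

End Edges.
End FixedConfigurations.

(** * Invariant unmarked configurations and words *)

Lemma eq_height w w' : w =1 w' -> height w =1 height w'.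
Proof. by move=> E i; apply: eq_bigr => t _; rewrite E. Qed.

Lemma eq_wmatch n k w w' i j : w =1 w' -> wmatch n k w i j = wmatch n k w' i j.
Proof.
move=> E; have Ec x : close k w x = close k w' x.
  by rewrite /close; congr (_ + _.+1)%N; apply: eq_find => t; rewrite !(eq_height E).
by rewrite /wmatch !Ec !E.
Qed.

Lemma eq_mword n o k M M' lp lp' i : (forall x y, M x y = M' x y) -> lp =1 lp' ->
  mword n o k M lp i = mword n o k M' lp' i.
Proof.
move=> EM El; rewrite /mword El.
have -> : opens n o k M i = opens n o k M' i by apply: eq_has => t; rewrite EM.
by have -> : covered n M i = covered n M' i by apply: eq_has => t; rewrite EM.
Qed.

Section Bijection.

Variables (n o k : nat).
Hypotheses (n_ok : n = (o * k)%N) (o_gt0 : (0 < o)%N) (k_gt0 : (0 < k)%N) (n_gt0 : (0 < n)%N).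
Variables (e l : nat).

Notation vtx := (vtx n_gt0).
Notation chord := (chord n_gt0).
Notation joined := (joined n_gt0).
Notation r := (rot_perm n ^+ k)%g.

Definition fixed_pairs : {set {set {set 'I_n}} * {set 'I_n}} :=
  [set p : {set {set 'I_n}} * {set 'I_n} | [&& planar p.1, [disjoint p.2 & cover p.1],
    [set r @: A | A : {set 'I_n} in p.1] == p.1, r @: p.2 == p.2, #|p.1| == e & #|p.2| == l]].

(** For o > 1, the number of invariant diameters: there is none unless o = 2, and
    then the other edges are exchanged in pairs.  For o = 1 it is 0, the drift of
    a word whose brackets are all matched. *)
Definition drift : nat := (o == 2%N) && odd e.

Definition ballot (t : k.-tuple color) : bool :=
  [forall i : 'I_k.+1, 0 <= height (cyc t) i].

(** The words of invariant pairs; the first condition counts the 2 e endpoints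
    of edges, each colour being repeated o times around the circle. *)
Definition words : {set k.-tuple color} :=
  [set t : k.-tuple color | [&& o * (count_mem Op t + count_mem Cl t) == 2 * e, o * count_mem Lp t == l,
     count_mem Op t == count_mem Cl t + drift & (o == 1) ==> ballot t]%N].

Definition pair_loops (p : {set {set 'I_n}} * {set 'I_n}) (i : nat) : bool := vtx i \in p.2.

Definition pair_mword (p : {set {set 'I_n}} * {set 'I_n}) : nat -> color :=
  mword n o k (joined p.1) (pair_loops p).

Definition word_of (p : {set {set 'I_n}} * {set 'I_n}) : k.-tuple color :=
  [tuple pair_mword p i | i < k].

Definition pair_of (t : k.-tuple color) : {set {set 'I_n}} * {set 'I_n} :=
  (chords_of n_gt0 (wmatch n k (cyc t)), [set v : 'I_n | cyc t v == Lp]).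

Lemma card_cover2 (E : {set {set 'I_n}}) : planar E -> #|cover E| = (2 * #|E|)%N.
Proof.
case/and3P=> /forall_inP H2 /eqP <- _.
by rewrite (eq_bigr (fun=> 2%N)) ?sum_nat_const 1?mulnC // => A /H2/eqP.
Qed.

Section FromPair.

Variable p : {set {set 'I_n}} * {set 'I_n}.
Hypothesis pF : p \in fixed_pairs.

Let plE : planar p.1. Proof. by move: pF; rewrite inE => /and5P[]. Qed.
Let dLE : [disjoint p.2 & cover p.1]. Proof. by move: pF; rewrite inE => /and5P[]. Qed.
Let rE : [set r @: A | A : {set 'I_n} in p.1] = p.1.
Proof. by move: pF; rewrite inE => /and5P[_ _ /eqP]. Qed.
Let rL : r @: p.2 = p.2. Proof. by move: pF; rewrite inE => /and5P[_ _ _ /eqP]. Qed.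
Let cE : #|p.1| = e. Proof. by move: pF; rewrite inE => /and5P[_ _ _ _ /andP[/eqP]]. Qed.
Let cL : #|p.2| = l. Proof. by move: pF; rewrite inE => /and5P[_ _ _ _ /andP[_ /eqP]]. Qed.
Let mM : matching n k (joined p.1) := joined_matching plE (rot_joined n_gt0 rE).

Let lp_per i : pair_loops p (i + k) = pair_loops p i.
Proof.
by rewrite /pair_loops -(rot_permX n_gt0 k i) -{1}rL mem_imset //; apply: perm_inj.
Qed.

Let lpM i j : joined p.1 i j -> ~~ pair_loops p i.
Proof.
move=> m; apply/negP=> vL; have /pred0P/(_ (vtx i)) := dLE; rewrite /= [_ \in p.2]vL /=.
by move/negP; apply; apply/bigcupP; exists (chord i j); rewrite // !inE eqxx.
Qed.

Lemma cyc_word_of : cyc (word_of p) =1 pair_mword p.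
Proof.
move=> i; rewrite /cyc (nth_map (Ordinal (ltn_pmod i k_gt0))); last by rewrite size_enum_ord ltn_pmod.
rewrite nth_enum_ord ?ltn_pmod //.
have per q x : pair_mword p (x + q * k) = pair_mword p x.
  elim: q => [|q IH]; first by rewrite addn0.
  by rewrite mulSnr addnA /pair_mword (mword_per n_ok o_gt0 k_gt0 mM lp_per).
by rewrite {2}(divn_eq i k) addnC per.
Qed.

Definition drift_of : nat := if (1 < o)%N then #|fixed_edges k p.1| else 0%N.

Lemma drift_of_le1 : (drift_of <= 1)%N.
Proof. by rewrite /drift_of; case: ltnP => // o1; exact: (fixed_edges_le1 n_ok o_gt0 k_gt0 n_gt0 plE rE o1). Qed.

Lemma drift_of_o2 : drift_of = 1%N -> o = 2%N.
Proof.
rewrite /drift_of; case: ltnP => // o1 E.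
have /card_gt0P[A AF] : (0 < #|fixed_edges k p.1|)%N by rewrite E.
exact: (fixed_edges_o2 n_ok o_gt0 k_gt0 n_gt0 plE rE o1 AF).
Qed.

Lemma height_pair : height (pair_mword p) k = drift_of.
Proof.
have H : height (pair_mword p) n = height (pair_mword p) k *+ o.
  rewrite n_ok /height (@sum_periodic _ (fun i => step (pair_mword p i))) // => i.
  by rewrite addnC /pair_mword (mword_per n_ok o_gt0 k_gt0 mM lp_per).
rewrite /pair_mword in H *; rewrite height_bracket // in H.
rewrite (eq_bigl xpredT) in H; last by move=> v; rewrite ltn_ord.
rewrite /drift_of; case: (ltnP 1 o) => o1.
  rewrite (sum_steps n_ok o_gt0 k_gt0 n_gt0 plE rE o1) in H.
  have := fixed_edges_le1 n_ok o_gt0 k_gt0 n_gt0 plE rE o1.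
  rewrite leq_eqVlt ltnS leqn0 => /orP[/eqP E|/eqP E].
    have o2 : o = 2%N by apply: drift_of_o2; rewrite /drift_of o1.
    by move: H; rewrite E o2 mulr2n; set h := height _ _; lia.
  move: H; rewrite E muln0 => /esym/eqP; rewrite -mulr_natr mulf_eq0 pnatr_eq0.
  by rewrite (gtn_eqF o_gt0) orbF => /eqP.
have {}o1 : o = 1%N by lia.
rewrite (sum_steps_order1 n_ok o_gt0 k_gt0 n_gt0 plE rE o1) in H.
move/esym/eqP: H; rewrite -mulr_natr mulf_eq0 pnatr_eq0.
by rewrite (gtn_eqF o_gt0) orbF => /eqP.
Qed.

Lemma pair_periodic : periodic_word k (pair_mword p) drift_of.
Proof.
split=> //; [exact: mword_per|exact: height_pair|exact: drift_of_le1].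
Qed.

Lemma mem_brackets i : vtx i \in cover p.1 <-> pair_mword p i \in [:: Op; Cl].
Proof.
rewrite (cover_covered n_ok o_gt0 k_gt0 n_gt0 plE rE) !inE.
have oc : opens n o k (joined p.1) i -> covered n (joined p.1) i.
  by move/opensP=> [t [_ m _]]; apply/(coveredP n_ok o_gt0 k_gt0 mM); exists (i + t)%N.
rewrite /pair_mword /mword; case: opens oc => [/(_ isT)-> //|_].
by case: covered; case: pair_loops.
Qed.

Lemma word_of_words : word_of p \in words /\ drift_of = drift.
Proof.
have hE := height_cyc (word_of p).
rewrite (eq_height cyc_word_of) height_pair in hE.
have cb : (o * (count_mem Op (word_of p) + count_mem Cl (word_of p)) = 2 * e)%N.
  rewrite -cE -card_cover2 //.
  transitivity #|[set v : 'I_n | cyc (word_of p) v \in [:: Op; Cl]]|.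
    rewrite (card_cyc _ (mem [:: Op; Cl]) n_ok); congr (_ * _)%N.
    elim: (word_of p : seq _) => [|c s IH] //=; rewrite -IH !inE.
    by case: c => [[[]|]|] /=; lia.
  apply: eq_card => v; rewrite inE cyc_word_of.
  rewrite -[v in RHS](vtx_val n_gt0) [RHS](_ : _ = (vtx v \in cover p.1)) //.
  by apply/idP/idP=> /mem_brackets.
have cl : (o * count_mem Lp (word_of p) = l)%N.
  rewrite -(card_cyc _ (pred1 Lp) n_ok) -cL; apply: eq_card => v.
  rewrite inE cyc_word_of /= -{2}(vtx_val n_gt0 v).
  apply/eqP/idP; [move/mword_lp=> H; apply: H|move=> H; apply/mword_lp] => //.
have dE : drift_of = drift.
  rewrite /drift; have := drift_of_o2; have := drift_of_le1.
  case: (o =P 2%N) => [o2|no] /=.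
    by move: cb; rewrite o2; lia.
  by case: drift_of => // -[|//] _ /(_ erefl).
have cd : count_mem Op (word_of p) = (count_mem Cl (word_of p) + drift)%N by lia.
split=> //; rewrite inE cb cl -cd !eqxx /=.
apply/implyP=> /eqP o1; apply/forallP=> i; rewrite (eq_height cyc_word_of).
by apply: (height_ballot n_ok o_gt0 k_gt0 n_gt0 plE rE) => //; rewrite -ltnS.
Qed.

Lemma word_ofK : pair_of (word_of p) = p.
Proof.
rewrite /pair_of [RHS]surjective_pairing; congr (_, _).
  rewrite -[RHS](chords_of_joined n_gt0 plE); apply: eq_chords_of => i j.
  rewrite (eq_wmatch _ _ _ _ cyc_word_of).
  exact: (wmatch_mword n_ok o_gt0 k_gt0 mM pair_periodic drift_of_o2).
apply/setP=> v; rewrite inE cyc_word_of -{2}(vtx_val n_gt0 v).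
by apply/eqP/idP; [move/mword_lp=> H; apply: H|move=> H; apply/mword_lp].
Qed.

End FromPair.

Section FromWord.

Variable t : k.-tuple color.
Hypothesis tW : t \in words.

Let cb : (o * (count_mem Op t + count_mem Cl t) = 2 * e)%N.
Proof. by move: tW; rewrite inE => /and4P[/eqP]. Qed.
Let cl : (o * count_mem Lp t = l)%N. Proof. by move: tW; rewrite inE => /and4P[_ /eqP]. Qed.
Let cd : count_mem Op t = (count_mem Cl t + drift)%N.
Proof. by move: tW; rewrite inE => /and4P[_ _ /eqP]. Qed.

Lemma word_periodic : periodic_word k (cyc t) drift.
Proof.
split=> //; [exact: cyc_per|by rewrite height_cyc cd; lia|].
by rewrite /drift; case: (_ && _).
Qed.

Lemma drift_o2 : drift = 1%N -> o = 2%N.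
Proof. by rewrite /drift; case: eqP. Qed.

Let mM : matching n k (wmatch n k (cyc t)) := wmatch_matching word_periodic n_ok o_gt0 drift_o2.

Let cyc_vtx i : cyc t (vtx i) = cyc t i.
Proof. by rewrite /cyc /= n_ok modn_dvdm // dvdn_mull. Qed.

Lemma pair_of_cover i : (vtx i \in cover (pair_of t).1) = (cyc t i \in [:: Op; Cl]).
Proof.
have wc := wmatch_cover word_periodic n_ok o_gt0 drift_o2 i.
have plE := planar_chords_of n_gt0 mM.
apply/bigcupP/idP=> [[A AE vA]|].
  have [H2 _ _] := planarP _ plE; have [j EA] := card2_chord_at (H2 _ AE) vA.
  have : exists j, wmatch n k (cyc t) i j.
    by exists j; rewrite -(joined_chords_of n_gt0 mM) /joined -EA.
  by case/wc => ->.
rewrite !inE => H; have [] : exists j, wmatch n k (cyc t) i j.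
  by apply/wc; case/orP: H => /eqP->; [left|right].
move=> j m; exists (chord i j); last by rewrite !inE eqxx.
by apply/(chords_ofP n_gt0 mM); exists i, j.
Qed.

Lemma pair_of_fixed : pair_of t \in fixed_pairs.
Proof.
have plE := planar_chords_of n_gt0 mM.
rewrite inE plE /=; apply/and5P; split.
- apply/pred0P=> v /=; rewrite inE; have := pair_of_cover v; rewrite vtx_val /= => ->.
  by case: eqP => // ->.
- rewrite eqEcard card_imset ?leqnn ?andbT; last by apply: imset_inj; apply: perm_inj.
  apply/subsetP=> _ /imsetP[A /(chords_ofP n_gt0 mM)[i [j [-> m]]] ->].
  by apply/(chords_ofP n_gt0 mM); exists (i + k)%N, (j + k)%N; rewrite rot_chord (m_inv mM).
- rewrite eqEcard card_imset ?leqnn ?andbT; last exact: perm_inj.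
  apply/subsetP=> _ /imsetP[v vL ->]; rewrite inE -(vtx_val n_gt0 v) rot_permX cyc_vtx cyc_per.
  by move: vL; rewrite inE.
- rewrite -(eqn_pmul2l (ltn0Sn 1)) -card_cover2 // -cb; apply/eqP.
  transitivity #|[set v : 'I_n | cyc t v \in [:: Op; Cl]]|.
    by apply: eq_card => v; rewrite inE -pair_of_cover vtx_val.
  rewrite (card_cyc _ (mem [:: Op; Cl]) n_ok); congr (_ * _)%N.
  elim: (t : seq _) => [|c s IH] //=; rewrite IH !inE.
  by case: c => [[[]|]|] /=; lia.
by rewrite -cl -(card_cyc _ (pred1 Lp) n_ok).
Qed.

Lemma pair_ofK : word_of (pair_of t) = t.
Proof.
apply: eq_from_tnth => i; rewrite tnth_mktuple -cyc_tnth.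
rewrite -[RHS](mword_wmatch i word_periodic n_ok o_gt0 drift_o2).
  apply: eq_mword => [x y|x]; first exact: (joined_chords_of n_gt0 mM).
  by rewrite /pair_loops inE cyc_vtx.
move=> o1 x lex; move: tW; rewrite inE o1 /= => /and4P[_ _ _ /forallP].
by rewrite -ltnS in lex; move=> /(_ (Ordinal lex)).
Qed.

End FromWord.

(** Each of [word_of] and [pair_of] sends one set into the other and has the other
    map as a left inverse. *)
Lemma card_fixed_pairs : #|fixed_pairs| = #|words|.
Proof.
apply/eqP; rewrite eqn_leq; apply/andP; split.
  rewrite -(card_in_imset (f := word_of) (D := fixed_pairs)).
    by apply/subset_leq_card/subsetP=> _ /imsetP[p pF ->]; have [] := word_of_words pF.
  by move=> p q pF qF E; rewrite -(word_ofK pF) E word_ofK.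
rewrite -(card_in_imset (f := pair_of) (D := words)).
  by apply/subset_leq_card/subsetP=> _ /imsetP[t tW ->]; apply: pair_of_fixed.
by move=> s t sW tW E; rewrite -(pair_ofK sW) E pair_ofK.
Qed.

End Bijection.

(** * Counting words *)

Definition nwords k (P : pred (seq color)) : nat := #|[set t : k.-tuple color | P t]|.

Lemma eq_nwords k (P Q : pred (seq color)) :
  (forall s, size s = k -> P s = Q s) -> nwords k P = nwords k Q.
Proof. by move=> E; apply: eq_card => t; rewrite !inE E ?size_tuple. Qed.

Lemma nwords_none k (P : pred (seq color)) : (forall s, size s = k -> P s = false) -> nwords k P = 0%N.
Proof. by move=> E; apply: eq_card0 => t; rewrite !inE E ?size_tuple. Qed.

Lemma nwordsS k P : nwords k.+1 P =
  (nwords k (fun s => P (Op :: s)) + nwords k (fun s => P (Cl :: s)) +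
   nwords k (fun s => P (Lp :: s)) + nwords k (fun s => P (Bl :: s)))%N.
Proof.
have E c : nwords k (fun s => P (c :: s)) = #|[set t : k.+1.-tuple color | P t & thead t == c]|.
  rewrite /nwords -(card_imset (f := fun t : k.-tuple color => [tuple of c :: t])); last first.
    by move=> s t /(congr1 val)[] E; apply: val_inj.
  apply: eq_card => t; rewrite !inE; apply/imsetP/andP=> [[s] | [Pt /eqP tc]].
    by rewrite inE => Ps ->; rewrite theadE eqxx.
  exists [tuple of behead t]; last by apply: val_inj; rewrite /= -tc [in LHS](tuple_eta t).
  by rewrite inE /= -tc; move: Pt; rewrite {1}(tuple_eta t).
rewrite !E /nwords -!sum1dep_card.
have sp c : (\sum_(t : k.+1.-tuple color | P t && (thead t == c)) 1 =
   \sum_(t : k.+1.-tuple color | P t) (thead t == c))%N.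
  by rewrite big_mkcondr; apply: eq_bigr => t _; case: (_ == c).
rewrite !sp -!big_split /=; apply: eq_bigr => t _.
by case: (thead t) => [[[]|]|].
Qed.

Definition content (a b c : nat) : pred (seq color) :=
  fun s => [&& count_mem Op s == a, count_mem Cl s == b & count_mem Lp s == c].

Lemma content_size a b c s : content a b c s -> (a + b + c <= size s)%N.
Proof.
case/and3P=> /eqP<- /eqP<- /eqP<-; elim: s => //= x s IH.
by case: x => [[[]|]|] /=; lia.
Qed.

Lemma content_Op a b c s : content a b c (Op :: s) = (0 < a)%N && content a.-1 b c s.
Proof. by rewrite /content /=; case: a => [|a] //=; rewrite add1n eqSS !add0n. Qed.
Lemma content_Cl a b c s : content a b c (Cl :: s) = (0 < b)%N && content a b.-1 c s.
Proof.
by rewrite /content /= !add0n add1n; case: b => [|b] /=; rewrite ?andbF ?eqSS.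
Qed.
Lemma content_Lp a b c s : content a b c (Lp :: s) = (0 < c)%N && content a b c.-1 s.
Proof.
by rewrite /content /= !add0n add1n; case: c => [|c] /=; rewrite ?andbF ?eqSS.
Qed.

Lemma nwords_content a b c z :
  (nwords (a + b + c + z) (content a b c) * (a`! * b`! * c`! * z`!) = (a + b + c + z)`!)%N.
Proof.
move Ek: (a + b + c + z)%N => k; elim: k a b c z Ek => [|k IH] a b c z Ek.
  have [-> -> -> ->] : [/\ a = 0, b = 0, c = 0 & z = 0]%N by split; lia.
  rewrite /nwords (eq_card (_ : _ =i predT)) ?card_tuple //.
  by move=> t; rewrite (tuple0 t) inE.
rewrite nwordsS 3!mulnDl.
have -> : (nwords k (fun s => content a b c (Op :: s)) * (a`! * b`! * c`! * z`!) = k`! * a)%N.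
  case: a Ek => [|a] Ek; first by rewrite nwords_none ?muln0 // => s _; rewrite content_Op.
  rewrite (eq_nwords (Q := content a b c)); last by move=> s _; rewrite content_Op.
  by rewrite factS -(IH a b c z); [ring|lia].
have -> : (nwords k (fun s => content a b c (Cl :: s)) * (a`! * b`! * c`! * z`!) = k`! * b)%N.
  case: b Ek => [|b] Ek; first by rewrite nwords_none ?muln0 // => s _; rewrite content_Cl.
  rewrite (eq_nwords (Q := content a b c)); last by move=> s _; rewrite content_Cl.
  by rewrite factS -(IH a b c z); [ring|lia].
have -> : (nwords k (fun s => content a b c (Lp :: s)) * (a`! * b`! * c`! * z`!) = k`! * c)%N.
  case: c Ek => [|c] Ek; first by rewrite nwords_none ?muln0 // => s _; rewrite content_Lp.
  rewrite (eq_nwords (Q := content a b c)); last by move=> s _; rewrite content_Lp.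
  by rewrite factS -(IH a b c z); [ring|lia].
rewrite (eq_nwords (Q := content a b c)) //.
have -> : (nwords k (content a b c) * (a`! * b`! * c`! * z`!) = k`! * z)%N.
  case: z Ek => [|z] Ek.
    by rewrite nwords_none ?muln0 // => s sk; apply/negP=> /content_size; lia.
  by rewrite factS -(IH a b c z); [ring|lia].
by rewrite -!mulnDr Ek factS mulnC.
Qed.

Fixpoint stays_up (h : nat) (s : seq color) : bool :=
  if s is x :: s' then
    match x with
    | Some (Some true) => stays_up h.+1 s'
    | Some (Some false) => (0 < h)%N && stays_up h.-1 s'
    | _ => stays_up h s'
    end
  else true.

(** The ballot theorem for paths from height h down to 0, with blanks and loops.
    By induction on the first letter; the identity behind it is
    (h+2) a + h (b+1) = (h+1) (a+b) for b = a + h. *)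
Lemma nwords_ballot h a c z :
  (nwords (a + (a + h) + c + z) (fun s => content a (a + h) c s && stays_up h s) *
    (a`! * ((a + h).+1)`! * c`! * z`!) = h.+1 * (a + (a + h) + c + z)`!)%N.
Proof.
move Ek: (a + (a + h) + c + z)%N => k; elim: k h a c z Ek => [|k IH] h a c z Ek.
  have [-> -> -> ->] : [/\ a = 0, h = 0, c = 0 & z = 0]%N by split; lia.
  rewrite /nwords (eq_card (_ : _ =i predT)) ?card_tuple //.
  by move=> t; rewrite (tuple0 t) inE.
rewrite nwordsS 3!mulnDl.
set X := (a`! * _ * _ * _)%N.
have -> : (nwords k (fun s => content a (a + h) c (Op :: s) && stays_up h (Op :: s)) * X
    = h.+2 * k`! * a)%N.
  rewrite /X; case: a Ek {X} => [|a] Ek.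
    by rewrite nwords_none ?muln0 // => s _; rewrite content_Op.
  rewrite (eq_nwords (Q := fun s => content a (a + h.+1) c s && stays_up h.+1 s)).
    by rewrite factS -(IH h.+1 a c z) ?addSnnS; [ring|lia].
  by move=> s _; rewrite content_Op addSnnS.
have -> : (nwords k (fun s => content a (a + h) c (Cl :: s) && stays_up h (Cl :: s)) * X
    = h * k`! * (a + h).+1)%N.
  rewrite /X; case: h Ek {X} => [|h] Ek.
    by rewrite nwords_none ?mul0n // => s _ /=; rewrite andbF.
  rewrite (eq_nwords (Q := fun s => content a (a + h) c s && stays_up h s)).
    by rewrite addnS [(a + h).+2`!]factS -(IH h a c z); [ring|lia].
  by move=> s _; rewrite content_Cl addnS.
have -> : (nwords k (fun s => content a (a + h) c (Lp :: s) && stays_up h (Lp :: s)) * X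
    = h.+1 * k`! * c)%N.
  rewrite /X; case: c Ek {X} => [|c] Ek.
    by rewrite nwords_none ?muln0 // => s _; rewrite content_Lp.
  rewrite (eq_nwords (Q := fun s => content a (a + h) c s && stays_up h s)).
    by rewrite [c.+1`!]factS -(IH h a c z); [ring|lia].
  by move=> s _; rewrite content_Lp.
rewrite (eq_nwords (Q := fun s => content a (a + h) c s && stays_up h s)) //.
have -> : (nwords k (fun s => content a (a + h) c s && stays_up h s) * X = h.+1 * k`! * z)%N.
  rewrite /X; case: z Ek {X} => [|z] Ek.
    by rewrite nwords_none ?muln0 // => s sk; apply/negP=> /andP[/content_size]; lia.
  by rewrite [z.+1`!]factS -(IH h a c z); [ring|lia].
rewrite factS -Ek; ring.
Qed.

Lemma stays_upP h s : reflect
  (forall i, (i <= size s)%N -> 0 <= h%:Z + \sum_(j < i) step (nth Bl s j)) (stays_up h s).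
Proof.
elim: s h => [|x s IH] h.
  by apply: (iffP idP) => // _ [|i] //; rewrite big_ord0 addr0.
have cons_sum i : \sum_(j < i.+1) step (nth Bl (x :: s) j) =
    step x + \sum_(j < i) step (nth Bl s j) by rewrite big_ord_recl.
have shift h' : h%:Z + step x = h'%:Z -> stays_up h (x :: s) = stays_up h' s ->
    reflect (forall i, (i <= size (x :: s))%N -> 0 <= h%:Z + \sum_(j < i) step (nth Bl (x :: s) j))
      (stays_up h (x :: s)).
  move=> Eh ->; apply: (iffP (IH h')) => H.
    by case=> [|i] lei; rewrite ?big_ord0 ?addr0 // cons_sum addrA Eh; apply: H.
  by move=> i lei; have := H i.+1 lei; rewrite cons_sum addrA Eh.
case: x shift {cons_sum} => [[[]|]|] shift.
- by apply: (shift h.+1); rewrite //=; lia.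
- case: h shift => [|h] shift; last by apply: (shift h); rewrite //=; lia.
  by right=> H; have := H 1%N isT; rewrite big_ord1 /=.
- by apply: (shift h); rewrite //= addr0.
- by apply: (shift h); rewrite //= addr0.
Qed.

Lemma ballotE k (t : k.-tuple color) : ballot t = stays_up 0 t.
Proof.
have hE i : (i <= k)%N -> height (cyc t) i = \sum_(j < i) step (nth Bl t j).
  by move=> lei; apply: eq_bigr => j _; rewrite /cyc modn_small // (leq_trans _ lei).
apply/forallP/stays_upP=> H i.
  by rewrite size_tuple => lei; rewrite add0r -hE //; exact: (H (Ordinal (lei : i < k.+1)%N)).
have lei : (i <= k)%N by rewrite -ltnS.
by rewrite hE //; have := H i; rewrite size_tuple add0r => /(_ lei).
Qed.

(** The multinomial coefficient as a product of binomials, 0 outside its range. *)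
Lemma multinomialE N a b c k :
  ((a + b + c <= k)%N -> (N * (a`! * b`! * c`! * (k - (a + b + c))`!) = k`!)%N) ->
  ((k < a + b + c)%N -> N = 0%N) ->
  N = ('C(k, a + b) * 'C(a + b, a) * 'C(k - (a + b), c))%N.
Proof.
have [le|lt] := leqP (a + b + c) k => [/(_ isT) E _|_ /(_ isT) ->]; last first.
  have [lt'|le] := ltnP k (a + b); first by rewrite bin_small.
  by rewrite [X in (_ * X)%N]bin_small ?muln0 //; lia.
have pos : (0 < a`! * b`! * c`! * (k - (a + b + c))`!)%N by rewrite !muln_gt0 !fact_gt0.
apply/eqP; rewrite -(eqn_pmul2r pos) E; apply/eqP.
have E1 : ('C(k, a + b) * ((a + b)`! * (k - (a + b))`!) = k`!)%N by rewrite bin_fact //; lia.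
have E2 : ('C(a + b, a) * (a`! * b`!) = (a + b)`!)%N.
  by have := bin_fact (leq_addr b a); rewrite addKn.
have E3 : ('C(k - (a + b), c) * (c`! * (k - (a + b + c))`!) = (k - (a + b))`!)%N.
  by rewrite (subnDA (a + b)%N) bin_fact //; lia.
by rewrite -E1 -E2 -E3; ring.
Qed.

Lemma nwords_contentE k a b c :
  nwords k (content a b c) = ('C(k, a + b) * 'C(a + b, a) * 'C(k - (a + b), c))%N.
Proof.
apply: multinomialE => [le|lt].
  by have := nwords_content a b c (k - (a + b + c)); rewrite subnKC.
by apply: nwords_none => s sk; apply/negP=> /content_size; lia.
Qed.

(** Marking an edge or none multiplies the number of ballot words by 1 + a, which
    yields the number of all words. *)
Lemma nwords_ballotE k a c :
  ((1 + a) * nwords k (fun s => content a a c s && stays_up 0 s) =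
   'C(k, a + a) * 'C(a + a, a) * 'C(k - (a + a), c))%N.
Proof.
apply: multinomialE => [le|lt].
  have := nwords_ballot 0 a c (k - (a + a + c)); rewrite addn0 subnKC // mul1n => <-.
  by rewrite factS; ring.
by rewrite nwords_none ?muln0 // => s sk; apply/negP=> /andP[/content_size]; lia.
Qed.

(** * Fixed points of a power of the rotation *)

Lemma is_NCCE n (E : {set {set 'I_n}}) L m :
  is_NCC (E, L, m) = planar E && [disjoint L & cover E].
Proof. by rewrite /is_NCC /planar -!andbA. Qed.

Section FixedPoints.

Variables (n o k : nat).
Hypotheses (n_ok : n = (o * k)%N) (n_gt0 : (0 < n)%N).
Variables (e l : nat).

Let o_gt0 : (0 < o)%N. Proof. by move: n_gt0; rewrite n_ok muln_gt0 => /andP[]. Qed.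
Let k_gt0 : (0 < k)%N. Proof. by move: n_gt0; rewrite n_ok muln_gt0 => /andP[]. Qed.

Notation r := (rot_perm n ^+ k)%g.
Notation fixed := ('Fix_(NCCB n e l | config_action n)[r])%g.

Lemma mem_fixed E L m : ((E, L, m) : config n) \in fixed =
  ((E, L) \in fixed_pairs n k e l) && (if m is Some A then A \in fixed_edges k E else true).
Proof.
have triple : ((E, L, m) \in afix (config_action n) [set r]) =
   [&& [set r @: A | A : {set 'I_n} in E] == E, r @: L == L &
     omap (fun A : {set 'I_n} => r @: A) m == m].
  apply/afix1P/and3P => /= [[-> -> ->]|[/eqP E1 /eqP E2 /eqP E3]]; first by rewrite !eqxx.
  by rewrite /config_act /edges /loops /marked /= E1 E2 E3.
rewrite inE triple !inE /is_NCCB is_NCCE /edges /loops /marked /=.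
case: (planar E); case: [disjoint L & cover E]; case: (#|E| == e); case: (#|L| == l);
  case: (_ == E); case: (_ == L); rewrite ?andbF //=.
by case: m {triple} => [A|] //=; rewrite andbT inE (inj_eq Some_inj).
Qed.

Lemma card_fixed_sum :
  #|fixed| = (\sum_(p in fixed_pairs n k e l) (1 + #|fixed_edges k p.1|))%N.
Proof.
rewrite -sum1_card (partition_big (fun c : config n => c.1) (mem (fixed_pairs n k e l))) /=.
  apply: eq_bigr => p pF; rewrite sum1dep_card.
  pose marks : {set option {set 'I_n}} := None |: Some @: fixed_edges k p.1.
  have cm : #|marks| = (1 + #|fixed_edges k p.1|)%N.
    rewrite cardsU1 card_imset; last exact: Some_inj.
    by rewrite (_ : None \notin _) //; apply/imsetP=> -[].
  rewrite -cm -(card_imset (f := fun m => (p, m) : config n)); last by move=> ? ? [].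
  apply: eq_card => -[q m]; rewrite inE /=; apply/andP/imsetP => [[H /eqP Eq]|[m' m'F [-> ->]]].
    exists m; last by rewrite Eq.
    rewrite /marks; case: q H Eq => E L; rewrite mem_fixed => /andP[_ H] <-.
    by case: m H => [A H|_]; rewrite !inE // imset_f.
  split=> //; case: p pF @marks cm m'F => E L pF marks _; rewrite mem_fixed pF /=.
  by case: m' => // A; rewrite /marks !inE /= => /imsetP[B BF [->]]; move: BF; rewrite inE.
by move=> -[[E L] m] /=; rewrite mem_fixed => /andP[].
Qed.

Lemma card_fixed_words :
  #|fixed| = (#|words o k e l| * (1 + if o == 1 then e else drift o e))%N.
Proof.
rewrite card_fixed_sum -(card_fixed_pairs n_ok o_gt0 k_gt0 n_gt0) -sum_nat_const.
apply: eq_bigr => p pF; congr (1 + _)%N.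
have [_] := word_of_words n_ok o_gt0 k_gt0 n_gt0 pF; rewrite /drift_of => <-.
case: eqP => o1; last by rewrite (_ : 1 < o)%N //; lia.
have /eqP <- : #|p.1| == e by move: pF; rewrite inE => /and5P[_ _ _ _ /andP[]].
apply: eq_card => A; rewrite inE.
have -> : r = 1%g.
  apply/permP=> v; rewrite perm1 -(vtx_val n_gt0 v) rot_permX.
  have <- : n = k by rewrite n_ok o1 mul1n.
  by apply/eqP/vtxP; rewrite modnDr.
by rewrite imset_perm1 eqxx andbT.
Qed.

Lemma words_nwords P : (forall s, size s = k -> P s =
    [&& o * (count_mem Op s + count_mem Cl s) == 2 * e, o * count_mem Lp s == l,
      count_mem Op s == count_mem Cl s + drift o e & (o == 1) ==> stays_up 0 s]%N) ->
  #|words o k e l| = nwords k P.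
Proof.
by move=> H; apply: eq_card => t; rewrite !inE H ?size_tuple // ballotE.
Qed.

Lemma words_none : ~~ (o %| l)%N -> #|words o k e l| = 0%N.
Proof.
move=> nd; rewrite (words_nwords (P := pred0)) ?nwords_none // => s _.
by case: (_ =P l) nd => [<-|_]; rewrite ?dvdn_mulr ?andbF.
Qed.

Lemma card_fixed_dvd : (o %| e)%N ->
  #|fixed| = if (o %| l)%N then
    ('C(k, 2 * (e %/ o)) * 'C(2 * (e %/ o), e %/ o) * 'C(k - 2 * (e %/ o), l %/ o))%N else 0%N.
Proof.
move=> de; rewrite card_fixed_words; case: (boolP (o %| l)%N) => dl; last by rewrite words_none ?mul0n.
have {de}Ee : e = (o * (e %/ o))%N by rewrite mulnC divnK.
have {dl}El : l = (o * (l %/ o))%N by rewrite mulnC divnK.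
move: (e %/ o)%N (l %/ o)%N Ee El => p q Ee El.
have d0 : drift o e = 0%N.
  by rewrite /drift; case: eqP => // o2; rewrite Ee o2 oddM.
rewrite (words_nwords (P := fun s => content p p q s && ((o == 1%N) ==> stays_up 0 s))).
  case: eqP => [o1|_] /=.
    rewrite mul2n -addnn -nwords_ballotE mulnC; congr (_ * _)%N.
    by rewrite Ee o1 mul1n.
  rewrite d0 muln1 mul2n -addnn -nwords_contentE; apply: eq_nwords => s _.
  by rewrite andbT.
move=> s _; rewrite d0 Ee El /content mulnCA !eqn_pmul2l // addn0 -!andbA.
case: (stays_up 0 s); rewrite ?implybT ?implybF; lia.
Qed.

Lemma card_fixed_odd : o = 2%N -> odd e ->
  #|fixed| = if (o %| l)%N then
    (2 * ('C(k, e) * 'C(e, (e.+1)./2) * 'C(k - e, l %/ o)))%N else 0%N.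
Proof.
move=> o2 oe; rewrite card_fixed_words; case: (boolP (o %| l)%N) => dl; last by rewrite words_none ?mul0n.
have {dl}El : l = (o * (l %/ o))%N by rewrite mulnC divnK.
move: (l %/ o)%N El => q El.
have d1 : drift o e = 1%N by rewrite /drift o2 oe.
rewrite d1 o2 /= mulnC; congr (_ * _)%N.
have Ee : e = ((e.+1)./2 + (e.-1)./2)%N by lia.
transitivity (nwords k (content (e.+1)./2 (e.-1)./2 q)).
  rewrite -o2; apply: words_nwords => s _.
  rewrite d1 El o2 /content !eqn_pmul2l //=; lia.
by rewrite nwords_contentE -Ee.
Qed.

Lemma card_fixed_eq0 : ~~ (o %| e)%N -> ~~ ((o == 2%N) && odd e) -> #|fixed| = 0%N.
Proof.
move=> nd /negPf no2; rewrite card_fixed_words.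
rewrite (words_nwords (P := pred0)) ?nwords_none // => s _.
rewrite /drift no2 addn0; case: (_ =P 2 * e)%N => //= H.
case: (count_mem Op s =P _) => [E|_]; rewrite ?andbF //.
case/negP: nd; apply/dvdnP; exists (count_mem Op s).
by move/eqP: H; rewrite -E addnn -mul2n mulnCA eqn_pmul2l // mulnC => /eqP.
Qed.

Lemma card_fixed_qev (F : numFieldType) (w : F) : o.-primitive_root w ->
  #|fixed|%:R = qev w ((1 + qint e) * Ncc n e l).
Proof.
move=> pw; have [de|nde] := boolP (o %| e)%N.
  rewrite card_fixed_dvd //.
  rewrite -[e in qint e](divnK de) -[e in Ncc _ e](divnK de) ![(e %/ o * o)%N]mulnC n_ok.
  by rewrite qev_Ncc_dvd //; case: ifP.
have [/andP[/eqP o2 oe]|no] := boolP ((o == 2%N) && odd e).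
  by rewrite card_fixed_odd // n_ok qev_Ncc_odd //; case: ifP.
by rewrite card_fixed_eq0 // n_ok qev_Ncc_eq0.
Qed.

End FixedPoints.

(** * Cyclic sieving *)

Section Rotation.

Variables (n : nat) (n_gt0 : (0 < n)%N).

Notation vtx := (vtx n_gt0).
Notation chord := (chord n_gt0).
Notation rot := (rot_perm n).

Lemma rot_perm_eq1 m : (rot ^+ m == 1)%g = (n %| m)%N.
Proof.
apply/eqP/idP=> [E|/dvdnP[q ->]].
  have := rot_permX n_gt0 m 0; rewrite E perm1 add0n => /esym/eqP/vtxP.
  by rewrite mod0n => /eqP.
apply/permP=> v; rewrite perm1 -(vtx_val n_gt0 v) rot_permX.
by apply/eqP/vtxP; rewrite addnC modnMDl.
Qed.

Lemma order_rot_perm : #[rot]%g = n.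
Proof.
apply/eqP; rewrite eqn_dvd order_dvdn rot_perm_eq1 dvdnn /=.
by rewrite -rot_perm_eq1 expg_order.
Qed.

(** A crossing of the images is rotated back by n - 1 further steps on lifts,
    where [chord_crossing] applies. *)
Lemma rot_planar (E : {set {set 'I_n}}) : planar E ->
  planar [set rot @: A | A : {set 'I_n} in E].
Proof.
case/planarP=> H2 Ht Hc; have rinj : injective rot := perm_inj.
have card_rot (A : {set 'I_n}) : #|rot @: A| = #|A| by apply: card_imset.
apply/planarP; split.
- by move=> _ /imsetP[A AE ->]; rewrite card_rot H2.
- move=> _ _ v /imsetP[A AE ->] /imsetP[B BE ->] /imsetP[x xA ->].
  by rewrite mem_imset // => xB; rewrite (Ht _ _ _ AE BE xA xB).
move=> _ _ /imsetP[A AE ->] /imsetP[B BE ->]; apply/negP.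
case/existsP=> a /andP[aA /existsP[b /andP[bA /existsP[c /andP[cB /existsP[d]]]]]].
case/and4P=> dB ac cb bd.
have back X (x y : 'I_n) : X \in E -> x \in rot @: X -> y \in rot @: X -> (x < y)%N ->
    X = chord (x + n.-1) (y + n.-1).
  move=> XE xX yX ltxy; apply: (imset_inj rinj).
  have := rot_chord n_gt0 1 (x + n.-1) (y + n.-1); rewrite expg1 => ->.
  have En z : (z + n.-1 + 1 = z + n)%N by lia.
  have -> : chord (x + n.-1 + 1) (y + n.-1 + 1) = [set x; y].
    by rewrite /chord !En; congr [set _; _]; apply: val_inj; rewrite /= modnDr modn_small.
  apply/esym/eqP; rewrite eqEcard card_rot (eqP (H2 _ XE)) cards2.
  have -> /= : x != y by apply: contraTneq ltxy => ->; rewrite ltnn.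
  by rewrite andbT; apply/subsetP=> z; rewrite !inE => /orP[] /eqP->.
have EA := back _ _ _ AE aA bA ltac:(lia); have EB := back _ _ _ BE cB dB ltac:(lia).
have := @chord_crossing n n_gt0 (a + n.-1) (c + n.-1) (b + n.-1) (d + n.-1).
rewrite -EA -EB (negPf (Hc _ _ AE BE)) (negPf (Hc _ _ BE AE)) !ltn_add2r => /(_ ac cb bd).
by have := ltn_ord d; lia.
Qed.

Lemma rot_NCCB e l c : c \in NCCB n e l -> config_act c rot \in NCCB n e l.
Proof.
have rinj : injective rot := perm_inj.
case: c => [[E L] m]; rewrite !inE /is_NCCB /is_NCC /edges /loops /marked /=.
case/and3P=> /andP[/and4P[c2 tE nc dL] mE] cE cL.
have /and3P[-> -> ->] : planar [set rot @: A | A : {set 'I_n} in E].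
  by apply: rot_planar; apply/and3P.
rewrite !card_imset // ?cE ?cL /=; last by apply: imset_inj.
rewrite !andbT; apply/andP; split; last first.
  by case: m mE => //= A AE; apply: imset_f.
apply/pred0P=> _v /=; apply/negP=> /andP[/imsetP[x xL ->] /bigcupP[_ /imsetP[A AE ->]]].
rewrite mem_imset // => xA; have /pred0P/(_ x) := dL; rewrite /= xL /= => /negP; apply.
by apply/bigcupP; exists A.
Qed.

End Rotation.

(** By Bezout, g^m and g^gcd(m,n) are powers of each other. *)
Lemma fix_expg_gcd (aT : finGroupType) (T : finType) (to : {action aT &-> T}) (g : aT) m n x :
  (g ^+ n = 1)%g -> (to x (g ^+ m)%g == x) = (to x (g ^+ gcdn m n)%g == x).
Proof.
have pow h q : to x h = x -> to x (h ^+ q)%g = x.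
  by move=> fx; elim: q => [|q IH]; rewrite ?expg0 ?act1 // expgS actM fx.
move=> gn; apply/eqP/eqP=> H; last first.
  by have /dvdnP[q ->] := dvdn_gcdl m n; rewrite mulnC expgM pow.
case: (posnP m) => [->|m0]; first by rewrite gcd0n gn act1.
have [a b E _] := egcdnP n m0.
have := pow _ a H; rewrite -expgM mulnC E expgD mulnC expgM gn expg1n mul1g.
by [].
Qed.

(** Congruent to d modulo n, since - (m+1) = (m+1) (n-1) - (m+1) n. *)
Definition nat_exponent (n : nat) (d : int) : nat :=
  match d with Posz m => m | Negz m => (m.+1 * n.-1)%N end.

Theorem theorem50 (C : numClosedFieldType) (n e l : nat) (hn : (1 <= n)%N) :
  cyclic_sieving C n (rot_perm n) (config_action n) (NCCB n e l)
    ((1 + qint e) * Ncc n e l)%R.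
Proof.
have ordr := order_rot_perm hn.
have rn1 : (rot_perm n ^+ n = 1)%g by apply/eqP; rewrite (rot_perm_eq1 hn).
split=> //.
- rewrite cycle_subG !inE /=; apply/subsetP=> c cX; rewrite inE.
  exact: rot_NCCB.
- exact: coef_ge0_Ncc.
move=> xi pxi d; set m := nat_exponent n d.
have -> : expgz (rot_perm n) d = (rot_perm n ^+ m)%g.
  rewrite /m; case: d {m} => //= j; apply: (mulIg (rot_perm n ^+ j.+1)%g).
  by rewrite mulVg -expgD -mulnSr prednK // mulnC expgM rn1 expg1n.
have -> : xi ^ d = xi ^+ m.
  have xi0 : xi != 0 by rewrite (prim_root_eq0 pxi); lia.
  rewrite /m; case: d {m} => //= j; apply: (mulIf (expf_neq0 j.+1 xi0)).
  rewrite -exprD -mulnSr prednK // mulnC exprM (prim_expr_order pxi) expr1n.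
  by rewrite /exprz mulVf // expf_neq0.
have pw := exp_prim_root pxi m.
have gn : (0 < gcdn m n)%N by rewrite gcdn_gt0 hn orbT.
have nok : n = (n %/ gcdn m n * gcdn m n)%N by rewrite divnK ?dvdn_gcdr.
rewrite -[RHS](card_fixed_qev nok hn e l pw); congr (_%:R).
apply: eq_card => c; rewrite !in_setI; congr (_ && _).
have E := fix_expg_gcd (config_action n) m c rn1.
by apply/afix1P/afix1P=> /eqP H; apply/eqP; [rewrite -E|rewrite E].
Qed.
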